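(* Let $G_1, G_2, G_3$ be three directed graphs on a common set of $n$ vertices. If $e(G_i) > \left(\frac{52-4\sqrt{7}}{81}\right)n^2+ \frac{3}{2}n$ for every $i \in \{1,2,3\}$, then there exists a rainbow transitive triangle.
   Context: A directed graph $G$ consists of a vertex set $V(G)$ and an edge set $E(G)$ of ordered pairs of distinct vertices (no loops, no multiple edges; both $(u,v)$ and $(v,u)$ may be present). $e(G)=|E(G)|$. The edges of $G_i$ are thought of as having color $i$. A rainbow transitive triangle is a triple of distinct vertices $u,v,w$ together with pairwise distinct colors $a,b,d\in\{1,2,3\}$ such that $(u,v)\in E(G_a)$, $(v,w)\in E(G_b)$, $(u,w)\in E(G_d)$. *)

(* Defs.v *)
From mathcomp Require Import all_boot all_order all_algebra.
From mathcomp Require Import reals.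

Set Implicit Arguments.
Unset Strict Implicit.
Unset Printing Implicit Defensive.

(* Both (u, v) and (v, u) may be edges; as [edges] is a set, there are no
   multiple edges. *)
Record digraph (V : finType) := Digraph {
  edges : {set V * V};
  edges_loopless : forall u : V, (u, u) \notin edges
}.

Definition num_edges (V : finType) (G : digraph V) : nat := #|edges G|.

(* The three colors 1, 2, 3 are the elements 0, 1, 2 of ['I_3]. *)
Definition has_rainbow_transitive_triangle (V : finType)
    (G : 'I_3 -> digraph V) : Prop :=
  exists (u v w : V) (a b d : 'I_3),
    [/\ uniq [:: u; v; w], uniq [:: a; b; d],
        (u, v) \in edges (G a), (v, w) \in edges (G b)
      & (u, w) \in edges (G d)].

(* Main.v *)
Require Import Defs.
From mathcomp Require Import all_boot all_order all_algebra.
From mathcomp Require Import reals zify ring lra.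

Set Implicit Arguments.
Unset Strict Implicit.
Unset Printing Implicit Defensive.

Import Order.TTheory GRing.Theory Num.Theory.

(** Every triangle of edges pointing forward in a linear order is transitive.
    Enumerate the vertices and place each of them before or after all the later
    ones: the signs chosen contribute, for each colour, a signed sum of numbers
    bounded by n.  A point of the cube annihilating the sums of two colours,
    with nonnegative third sum and at most two fractional coordinates, can be
    rounded at a cost of 3n/2, so some order has at least e(G_i)/2 - 3n/4
    forward edges in each colour i.

    It remains to show that, for three undirected graphs without a rainbow
    triangle, two of the numbers of edges have sum at most (1 + t^2) n^2 / 2,
    where t = (4 - sqrt 7) / 9 is a root of 9 t^2 - 8 t + 1.  Pairs with all
    three colours can be deleted, and blowing up absorbs linear errors.
    Otherwise take a maximum matching among the pairs with two colours; let
    m_k be the number of vertices matched by pairs missing colour k, r the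
    number of unmatched vertices, and 1 the colour with the largest m_k.
    Writing s_k for the number of edges of the colours other than k, and
    P_k = m_k (m_k + r), comparing matched pairs two by two gives, up to linear
    errors,
      2 s_k <= n^2 + P_k,
      2 (s_1 + 3 (s_2 + s_3)) <= 6 n^2 + 2 m_1^2 + 4 (P_2 + P_3),
      2 (s_1 + 2 (s_2 + s_3)) <= 4 n^2 + 2 m_1^2 + 3 (P_2 + P_3) + m_1 r.
    If every s_k exceeds (1 + t^2) n^2 / 2, the first bound yields
    P_k > t^2 n^2, and then one of the other two is contradicted. *)

(** * Lists of colours and finite verifications *)

Definition clist := (bool * bool * bool)%type.
Definition col1 (l : clist) := l.1.1.
Definition col2 (l : clist) := l.1.2.
Definition col3 (l : clist) := l.2.
Definition ncol (l : clist) : nat := col1 l + col2 l + col3 l.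

Definition no_rainbow (x y z : clist) : bool :=
  ~~ [|| [&& col1 x, col2 y & col3 z], [&& col1 x, col3 y & col2 z],
         [&& col2 x, col1 y & col3 z], [&& col2 x, col3 y & col1 z],
         [&& col3 x, col1 y & col2 z] | [&& col3 x, col2 y & col1 z]].

Definition weight (w : nat * nat * nat) (l : clist) : nat :=
  (if col1 l then w.1.1 else 0) + (if col2 l then w.1.2 else 0)
  + (if col3 l then w.2 else 0).

(* Applied to lists of exactly two colours: the entry of [e] indexed by the
   colour which is absent from [l]. *)
Definition at_missing (e : nat * nat * nat) (l : clist) : nat :=
  if ~~ col1 l then e.1.1 else if ~~ col2 l then e.1.2 else e.2.

Definition small_lists : seq clist :=
  [:: (false, false, false); (true, false, false); (false, true, false);
      (false, false, true); (true, true, false); (true, false, true);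
      (false, true, true)].

Definition double_lists : seq clist :=
  [:: (true, true, false); (true, false, true); (false, true, true)].

Lemma mem_small_lists l : ncol l < 3 -> l \in small_lists.
Proof. by case: l => [[[] []] []]. Qed.

Lemma mem_double_lists l : ncol l = 2 -> l \in double_lists.
Proof. by case: l => [[[] []] []]. Qed.

(** Bounds the four edges between two matched pairs. Summed over ordered couples of pairs, the
    correction gives [e_k * n_k^2] for each colour k, where n_k = m_k / 2 pairs miss k. *)
Definition pair_bound (b : nat) (e : nat * nat * nat) (a a' : clist) : nat :=
  4 * b + (if a == a' then at_missing e a else 0).

(* [a] and [a'] are the lists of two disjoint pairs [u v] and [x z], and [c1],
   [c2], [c3], [c4] those of [u x], [u z], [v x], [v z]; the lists [d1], [d2],
   [d3], [d4] join a further vertex to [u], [v], [x], [z]. *)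
Definition vertex_quad_check (w : nat * nat * nat) (v : nat)
    (a a' c1 c2 c3 c4 : clist) : bool :=
  all (fun d1 => all (fun d2 => if no_rainbow d1 d2 a then
    all (fun d3 => if no_rainbow d1 d3 c1 && no_rainbow d2 d3 c3 then
      all (fun d4 => if [&& no_rainbow d1 d4 c2, no_rainbow d2 d4 c4
                          & no_rainbow d3 d4 a']
        then weight w d1 + weight w d2 + weight w d3 + weight w d4 <= v
        else true) small_lists
    else true) small_lists
  else true) small_lists) small_lists.

(* The bound [pair_bound] may fail by at most [2], and only between pairs
   missing colours 2 and 3 respectively; every further vertex then has weight
   at most [v] towards the four vertices. *)
Definition pair_pair_check w b e v : bool :=
  all (fun a => all (fun a' => all (fun c1 => all (fun c2 =>
    if no_rainbow c1 c2 a' then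
    all (fun c3 => if no_rainbow a c1 c3 then
      all (fun c4 => if no_rainbow a c2 c4 && no_rainbow c3 c4 a' then
        let W := weight w c1 + weight w c2 + weight w c3 + weight w c4 in
        let B := pair_bound b e a a' in
        if W <= B then true else
        if [&& a != a', col1 a, col1 a' & W <= B + 2]
        then vertex_quad_check w v a a' c1 c2 c3 c4 else false
      else true) small_lists
    else true) small_lists
  else true) small_lists) small_lists) double_lists) double_lists.

Definition pair_vertex_check w b f : bool :=
  all (fun a => all (fun d1 => all (fun d2 =>
    if no_rainbow d1 d2 a && ~~ ((ncol d1 == 2) && (ncol d2 == 2))
    then weight w d1 + weight w d2 <= 2 * b + at_missing f a
    else true) small_lists) small_lists) double_lists.

(* The weights [(6, 4, 4)] and [(4, 3, 3)] are [s1 + 3 (s2 + s3)] and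
   [s1 + 2 (s2 + s3)], where [sk] counts the edges of the two colours other
   than [k]. *)
Lemma pair_pair_check_644 : pair_pair_check (6, 4, 4) 6 (8, 16, 16) 32.
Proof. by vm_compute. Qed.

Lemma pair_pair_check_433 : pair_pair_check (4, 3, 3) 4 (8, 12, 12) 22.
Proof. by vm_compute. Qed.

(** These weights count the edges of s_2. Two pairs carrying colours 1 and 3 may have all eight such
    edges between them, hence the correction 4. *)
Lemma pair_pair_check_101 : pair_pair_check (1, 0, 1) 1 (0, 4, 0) 4.
Proof. by vm_compute. Qed.

Lemma pair_pair_check_110 : pair_pair_check (1, 1, 0) 1 (0, 0, 4) 4.
Proof. by vm_compute. Qed.

(** * Maximum matchings and total weights *)

Lemma sum_cons2 (T : Type) (W : T -> T -> nat) (p q : T) (s : seq T) :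
  (forall x y, W x y = W y x) ->
  \sum_(x <- [:: p, q & s]) \sum_(y <- [:: p, q & s]) W x y =
  W p p + 2 * W p q + W q q + 2 * \sum_(t <- s) (W t p + W t q)
  + \sum_(x <- s) \sum_(y <- s) W x y.
Proof.
move=> symW.
have E a : \sum_(t <- s) W a t = \sum_(t <- s) W t a.
  by apply: eq_bigr => t _; exact: symW.
have E2 : \sum_(t <- s) \sum_(y <- [:: p, q & s]) W t y =
    \sum_(t <- s) W t p + \sum_(t <- s) W t q
    + \sum_(t <- s) \sum_(y <- s) W t y.
  by rewrite -!big_split; apply: eq_bigr => t _ /=; rewrite !big_cons addnA.
rewrite [in LHS]big_cons [X in _ + X = _]big_cons E2 !big_cons (symW q p) !E.
rewrite big_split /=; lia.
Qed.

(* Two indices violating the bound [B] are removed together: by hypothesis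
   their joint interaction with every other index obeys the bound again, so
   only a linear error survives. *)
Lemma sum_pairs_le (T : eqType) (W B : T -> T -> nat) (c : nat) (s : seq T) :
  (forall x y, W x y = W y x) -> (forall x y, B x y = B y x) -> uniq s ->
  (forall p, p \in s -> W p p <= B p p) ->
  (forall p q, p \in s -> q \in s -> p != q -> W p q <= B p q \/
    W p q <= B p q + c /\
    forall t, t \in s -> t != p -> t != q -> W t p + W t q <= B t p + B t q) ->
  \sum_(p <- s) \sum_(q <- s) W p q <=
    \sum_(p <- s) \sum_(q <- s) B p q + c * size s.
Proof.
move=> symW symB; have [n] := ubnP (size s); elim: n s => // n IHn s.
rewrite ltnS => size_s uniq_s diag off.
have [/allP allWB|/allPn [p ps /allPn [q qs WBpq]]] :=
  boolP (all (fun p => all (fun q => W p q <= B p q) s) s).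
  apply: leq_trans (leq_addr _ _).
  rewrite big_seq [X in _ <= X]big_seq; apply: leq_sum => p ps.
  rewrite big_seq [X in _ <= X]big_seq; apply: leq_sum => q qs.
  exact: (allP (allWB p ps)).
have npq : p != q by apply: contraNneq WBpq => <-; exact: diag.
have [|[WBc Wt]] := off p q ps qs npq; first by rewrite (negPf WBpq).
have [s' perm_s] : exists s', perm_eq s [:: p, q & s'].
  exists (rem q (rem p s)); rewrite (perm_trans (perm_to_rem ps)) // perm_cons.
  by apply: perm_to_rem; rewrite mem_rem_uniq // !inE eq_sym npq.
have /= := uniq_s; rewrite (perm_uniq perm_s) /= inE negb_or.
case/and3P=> /andP [_ ps'] qs' uniq_s'.
have sub t : t \in s' -> t \in s.
  by rewrite (perm_mem perm_s) !inE => ->; rewrite !orbT.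
have size_s' : size s = (size s').+2 by rewrite (perm_size perm_s).
have IH : \sum_(p <- s') \sum_(q <- s') W p q <=
    \sum_(p <- s') \sum_(q <- s') B p q + c * size s'.
  apply: IHn => //; first by rewrite -ltnS -size_s' ltnW.
    by move=> t /sub; exact: diag.
  move=> t t' /sub ts /sub t's ntt'; case: (off t t' ts t's ntt'); first by left.
  by case=> ? Ht; right; split=> // x /sub; exact: Ht.
have mid : \sum_(t <- s') (W t p + W t q) <= \sum_(t <- s') (B t p + B t q).
  rewrite big_seq [X in _ <= X]big_seq; apply: leq_sum => t ts'.
  apply: Wt; first exact: sub.
    by apply: contraNneq ps' => <-.
  by apply: contraNneq qs' => <-.
have permE (F : T -> T -> nat) :
    \sum_(x <- s) \sum_(y <- s) F x y =
    \sum_(x <- [:: p, q & s']) \sum_(y <- [:: p, q & s']) F x y.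
  rewrite (perm_big _ perm_s); apply: eq_bigr => x _; exact: perm_big.
rewrite !permE (sum_cons2 _ _ _ symW) (sum_cons2 _ _ _ symB) size_s'.
have := diag p ps; have := diag q qs.
move: IH mid WBc; set a := \sum_(_ <- _) \sum_(_ <- _) _.
set a' := \sum_(_ <- _) \sum_(_ <- _) _.
set m := \sum_(_ <- _) _; set m' := \sum_(_ <- _) _; nia.
Qed.

Definition verts (V : Type) (s : seq (V * V)) : seq V :=
  flatten [seq [:: p.1; p.2] | p <- s].

Lemma sum_verts (V : Type) (s : seq (V * V)) (F : V -> nat) :
  \sum_(x <- verts s) F x = \sum_(p <- s) (F p.1 + F p.2).
Proof.
elim: s => [|p s IH]; first by rewrite !big_nil.
by rewrite /verts /= !big_cons -/(verts s) IH addnA.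
Qed.

Lemma mem_verts (V : eqType) (s : seq (V * V)) (p : V * V) :
  p \in s -> (p.1 \in verts s) && (p.2 \in verts s).
Proof.
move=> ps; apply/andP; split; apply/flattenP; exists [:: p.1; p.2];
  by [exact: map_f|rewrite !inE eqxx ?orbT].
Qed.

Lemma uniq_verts (V : eqType) (s : seq (V * V)) : uniq (verts s) -> uniq s.
Proof.
elim: s => //= p s IH /and3P [p1 p2 us]; rewrite IH // andbT.
by apply: contraNN p2 => /mem_verts /andP [].
Qed.

Lemma perm_verts (V : eqType) (s t : seq (V * V)) :
  perm_eq s t -> perm_eq (verts s) (verts t).
Proof.
move=> pst; apply/permP => a; rewrite !count_flatten -!map_comp.
by rewrite !sumnE !big_map; exact: perm_big.
Qed.

Lemma size_verts (V : Type) (s : seq (V * V)) : size (verts s) = 2 * size s.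
Proof. by elim: s => //= p s IH; rewrite -/(verts s) IH; lia. Qed.

(** The list version of a Gallai colouring. The empty diagonal makes the last condition trivial when
    vertices coincide. *)
Definition gallai (V : Type) (col : V -> V -> clist) : Prop :=
  [/\ forall x y, col x y = col y x, forall x, col x x = (false, false, false)
    & forall x y z, no_rainbow (col x y) (col x z) (col y z)].

(** Ordered pairs: every edge counts twice, so the weights [(0, 1, 1)] give 2 s_1. *)
Definition total (V : finType) (col : V -> V -> clist) (w : nat * nat * nat)
    (S : {set V}) : nat :=
  \sum_(x in S) \sum_(y in S) weight w (col x y).

(** The last two clauses exclude augmenting paths of length one and three in the graph of
    two-coloured pairs; [y = z] stays possible, since a path needs distinct ends. *)
Definition maximum_matching (V : finType) (col : V -> V -> clist)
    (S : {set V}) (s : seq (V * V)) (r : seq V) : Prop :=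
  [/\ perm_eq (enum S) (verts s ++ r),
      forall p, p \in s -> ncol (col p.1 p.2) = 2,
      forall x y, x \in r -> y \in r -> ncol (col x y) < 2
    & forall p y z, p \in s -> y \in r -> z \in r ->
        ncol (col p.1 y) = 2 -> ncol (col p.2 z) = 2 -> y = z].

(** Take a matching of largest size: a two-coloured pair inside [r] could be added, and [(u, v)]
    with distinct [y], [z] could be replaced by [(u, y)] and [(v, z)]. *)
Lemma maximum_matchingP (V : finType) (col : V -> V -> clist) (S : {set V}) :
  gallai col ->
  (forall x y, x \in S -> y \in S -> ncol (col x y) < 3) ->
  exists s r, maximum_matching col S s r.
Proof.
move=> [symc irrc _] small.
pose ok (s : seq (V * V)) := [&& uniq (verts s),
  all (fun x => x \in S) (verts s) & all (fun p => ncol (col p.1 p.2) == 2) s].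
pose P k := [exists t : k.-tuple (V * V), ok t].
have P0 : exists k, P k by exists 0; apply/existsP; exists [tuple].
have Pmax k : P k -> k <= #|V|.
  case/existsP=> t /and3P [ut _ _].
  have : size (verts t) <= #|V| by rewrite -(card_uniqP ut) max_card.
  by rewrite size_verts size_tuple; lia.
case: (ex_maxnP P0 Pmax) => k /existsP [s okS] kmax.
have maxS s' : ok s' -> size s' <= size s.
  move=> oks'; rewrite size_tuple; apply: kmax; apply/existsP.
  by exists (in_tuple s').
move: (tval s) okS maxS => {kmax Pmax P0}s /and3P [us sS sd] maxS.
pose r := [seq x <- enum S | x \notin verts s].
have rP x : x \in r = (x \in S) && (x \notin verts s).
  by rewrite mem_filter mem_enum andbC.
exists s, r; split.
- apply: uniq_perm; first exact: enum_uniq.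
    rewrite cat_uniq us filter_uniq ?enum_uniq // andbT /=.
    by apply/hasPn => x; rewrite rP => /andP [].
  move=> x; rewrite mem_cat rP mem_enum.
  case: (boolP (x \in verts s)) => [xs|]; last by rewrite andbT.
  by rewrite (allP sS x xs).
- by move=> p ps; apply/eqP; exact: (allP sd).
- move=> x y; rewrite !rP => /andP [xS xs] /andP [yS ys].
  rewrite ltnNge; apply/negP => xy2.
  have xy : ncol (col x y) == 2 by rewrite eqn_leq xy2 -ltnS small.
  have nxy : x != y by apply: contraTneq xy => ->; rewrite irrc.
  suff: ok ((x, y) :: s) by move/maxS; rewrite /= ltnn.
  rewrite /ok /= -/(verts s) inE negb_or nxy xs ys us xS yS sS xy.
  by [].
- move=> [u v] y z ps; rewrite !rP /= => /andP [yS ys] /andP [zS zs] uy vz.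
  apply/eqP; apply: contraT => nyz.
  pose s' := rem (u, v) s.
  have perm_s : perm_eq s ((u, v) :: s') := perm_to_rem ps.
  have perm_v : perm_eq (verts s) [:: u, v & verts s'].
    exact: perm_verts perm_s.
  suff /maxS : ok [:: (u, y), (v, z) & s'].
    by rewrite (perm_size perm_s) /= ltnn.
  move: us sS ys zs sd; rewrite (perm_uniq perm_v) !(perm_mem perm_v).
  rewrite (perm_all _ perm_v) (perm_all _ perm_s) /= !inE !negb_or.
  case/and3P => /andP [nuv us'] vs' us /and3P [uS vS sS].
  case/and3P => nyu nyv ys' /and3P [nzu nzv zs'] /andP [_ sd].
  rewrite /ok /= -/(verts s') !inE !negb_or uy vz yS zS uS vS sS sd us nuv us' vs'.
  by rewrite ys' zs' nyv nyz (eq_sym u y) nyu (eq_sym u z) nzu (eq_sym v z) nzv.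
Qed.

Definition pair_weight (V : Type) (col : V -> V -> clist) (w : nat * nat * nat)
    (p q : V * V) : nat :=
  weight w (col p.1 q.1) + weight w (col p.1 q.2)
  + weight w (col p.2 q.1) + weight w (col p.2 q.2).

Lemma vertex_quad_checkP (V : Type) (col : V -> V -> clist) w k
    (u v x z y : V) :
  gallai col ->
  vertex_quad_check w k (col u v) (col x z) (col u x) (col u z) (col v x)
    (col v z) ->
  ncol (col y u) < 3 -> ncol (col y v) < 3 -> ncol (col y x) < 3 ->
  ncol (col y z) < 3 ->
  weight w (col y u) + weight w (col y v) + weight w (col y x)
    + weight w (col y z) <= k.
Proof.
move=> [symc irrc nr] chk /mem_small_lists yu /mem_small_lists yv.
move=> /mem_small_lists yx /mem_small_lists yz.
move/allP: chk => /(_ _ yu) /allP /(_ _ yv); rewrite nr => /allP /(_ _ yx).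
by rewrite !nr => /allP /(_ _ yz); rewrite !nr.
Qed.

Lemma pair_pair_checkP (V : Type) (col : V -> V -> clist) w b e k
    (p q : V * V) :
  gallai col -> pair_pair_check w b e k ->
  ncol (col p.1 p.2) = 2 -> ncol (col q.1 q.2) = 2 ->
  ncol (col p.1 q.1) < 3 -> ncol (col p.1 q.2) < 3 ->
  ncol (col p.2 q.1) < 3 -> ncol (col p.2 q.2) < 3 ->
  let B := pair_bound b e (col p.1 p.2) (col q.1 q.2) in
  pair_weight col w p q <= B \/
  [/\ pair_weight col w p q <= B + 2,
      [&& col p.1 p.2 != col q.1 q.2, col1 (col p.1 p.2) & col1 (col q.1 q.2)]
    & vertex_quad_check w k (col p.1 p.2) (col q.1 q.2) (col p.1 q.1)
        (col p.1 q.2) (col p.2 q.1) (col p.2 q.2)].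
Proof.
case: p q => [u v] [x z] /= [symc irrc nr] chk.
move=> /mem_double_lists uv /mem_double_lists xz /mem_small_lists ux.
move=> /mem_small_lists uz /mem_small_lists vx /mem_small_lists vz.
move/allP: chk => /(_ _ uv) /allP /(_ _ xz) /allP /(_ _ ux) /allP /(_ _ uz).
rewrite nr => /allP /(_ _ vx); rewrite nr => /allP /(_ _ vz).
rewrite !nr /= /pair_weight /=.
case: leqP => [|_]; first by left.
by case: ifP => // /and4P [-> -> ->]; right.
Qed.

(** [a] and [a'] miss colours 2 and 3 in some order, and [c] misses one of these, so [c] equals
    exactly one of them. *)
Lemma pair_bound_add b e (a a' c : clist) :
  a != a' -> col1 a -> col1 a' -> col1 c ->
  ncol a = 2 -> ncol a' = 2 -> ncol c = 2 ->
  pair_bound b e c a + pair_bound b e c a' = 8 * b + at_missing e c.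
Proof.
rewrite /pair_bound.
case: a => [[[] []] []] //; case: a' => [[[] []] []] // _ _ _ + _ _;
case: c => [[[] []] []] //= _ _; lia.
Qed.

Lemma sum_at_missing (T : Type) (a : T -> clist) (g : nat * nat * nat)
    (s : seq T) :
  all (fun p => ncol (a p) == 2) s ->
  \sum_(p <- s) at_missing g (a p) =
    g.1.1 * count (fun p => ~~ col1 (a p)) s
    + g.1.2 * count (fun p => ~~ col2 (a p)) s
    + g.2 * count (fun p => ~~ col3 (a p)) s.
Proof.
elim: s => [|p s IH] /=; first by rewrite big_nil !muln0.
case/andP => ap /IH; rewrite big_cons => ->.
by move: ap; rewrite /at_missing; case: (a p) => [[[] []] []] //= _; lia.
Qed.

Lemma sum_pair_bound (T : eqType) (a : T -> clist) b (e : nat * nat * nat)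
    (s : seq T) :
  all (fun p => ncol (a p) == 2) s ->
  \sum_(p <- s) \sum_(q <- s) pair_bound b e (a p) (a q) =
    4 * b * size s ^ 2 + e.1.1 * count (fun p => ~~ col1 (a p)) s ^ 2
    + e.1.2 * count (fun p => ~~ col2 (a p)) s ^ 2
    + e.2 * count (fun p => ~~ col3 (a p)) s ^ 2.
Proof.
move=> dbl.
set n1 := count _ s; set n2 := count _ s; set n3 := count _ s.
have inner l : ncol l = 2 -> \sum_(q <- s) pair_bound b e l (a q) =
    4 * b * size s + at_missing (e.1.1 * n1, e.1.2 * n2, e.2 * n3) l.
  move=> dl; rewrite /n1 /n2 /n3; elim: s dbl {n1 n2 n3} => [_|q s IH] /=.
    by rewrite big_nil /at_missing /= !muln0 !if_same.
  case/andP => aq /IH; rewrite big_cons => ->.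
  move: dl aq; rewrite /pair_bound /at_missing.
  by case: l {IH} => [[[] []] []] //= _; case: (a q) => [[[] []] []] //= _; lia.
transitivity (\sum_(p <- s)
    (4 * b * size s + at_missing (e.1.1 * n1, e.1.2 * n2, e.2 * n3) (a p))).
  apply: eq_big_seq => p ps.
  by apply: inner; apply/eqP; exact: (allP dbl).
rewrite big_split /= sum_at_missing // big_const_seq count_predT iter_addn_0 /=.
rewrite -/n1 -/n2 -/n3; nia.
Qed.

Lemma weight_le w l : weight w l <= w.1.1 + w.1.2 + w.2.
Proof. by rewrite /weight; do 3 case: ifP => _; lia. Qed.

Lemma weight_single_le w b l : ncol l < 2 ->
  w.1.1 <= b -> w.1.2 <= b -> w.2 <= b -> weight w l <= b.
Proof. by rewrite /weight; case: l => [[[] []] []] //= _; lia. Qed.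

Lemma weight_double_le w b l : ncol l = 2 ->
  w.1.1 <= b -> w.1.2 <= b -> w.2 <= b ->
  weight w (false, false, false) + weight w l + weight w l <= 4 * b.
Proof. by rewrite /weight; case: l => [[[] []] []] //= _; lia. Qed.

Lemma pair_vertex_checkP (V : Type) (col : V -> V -> clist) w b f (u v y : V) :
  gallai col -> pair_vertex_check w b f ->
  ncol (col u v) = 2 -> ncol (col u y) < 3 -> ncol (col v y) < 3 ->
  ~~ ((ncol (col u y) == 2) && (ncol (col v y) == 2)) ->
  weight w (col u y) + weight w (col v y) <= 2 * b + at_missing f (col u v).
Proof.
move=> [symc irrc nr] chk /mem_double_lists uv /mem_small_lists uy.
move=> /mem_small_lists vy ex.
move/allP: chk => /(_ _ uv) /allP /(_ _ uy) /allP /(_ _ vy).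
by rewrite ex symc (symc v y) nr.
Qed.

(* At most one vertex of [r] is joined by two colours to both ends of [p]; it
   accounts for the last summand. *)
Lemma sum_pair_rest (V : eqType) (col : V -> V -> clist) w b f (p : V * V)
    (r : seq V) :
  gallai col -> pair_vertex_check w b f -> uniq r ->
  ncol (col p.1 p.2) = 2 ->
  (forall y, y \in r -> ncol (col p.1 y) < 3) ->
  (forall y, y \in r -> ncol (col p.2 y) < 3) ->
  (forall y z, y \in r -> z \in r ->
    ncol (col p.1 y) = 2 -> ncol (col p.2 z) = 2 -> y = z) ->
  \sum_(y <- r) (weight w (col p.1 y) + weight w (col p.2 y)) <=
    (2 * b + at_missing f (col p.1 p.2)) * size r
    + 2 * (w.1.1 + w.1.2 + w.2).
Proof.
move=> gcol chk ur dp s1 s2 ex.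
pose X y := (ncol (col p.1 y) == 2) && (ncol (col p.2 y) == 2).
have good t : {subset t <= r} -> (forall y, y \in t -> ~~ X y) ->
    \sum_(y <- t) (weight w (col p.1 y) + weight w (col p.2 y)) <=
    (2 * b + at_missing f (col p.1 p.2)) * size t.
  move=> tr nX; set c := 2 * b + _.
  have -> : c * size t = \sum_(y <- t) c.
    by rewrite big_const_seq count_predT iter_addn_0.
  rewrite big_seq [X in _ <= X]big_seq; apply: leq_sum => y yt.
  by apply: pair_vertex_checkP; rewrite ?s1 ?s2 ?tr //; exact: nX.
have [/hasP [y yr Xy]|/hasPn nX] := boolP (has X r); last first.
  by apply: leq_trans (leq_addr _ _); exact: good.
rewrite (perm_big _ (perm_to_rem yr)) big_cons /= addnC; apply: leq_add.
  apply: leq_trans (good (rem y r) _ _) _; last by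
    rewrite leq_mul2l size_rem // leq_pred orbT.
    by move=> z /mem_rem.
  move=> z; rewrite mem_rem_uniq // => /andP [nzy zr]; apply/negP => /andP [Xz _].
  by case/negP: nzy; apply/eqP/ex => //; [exact/eqP|case/andP: Xy => _ /eqP].
by have := weight_le w (col p.1 y); have := weight_le w (col p.2 y); lia.
Qed.

Definition missing_count (V : Type) (col : V -> V -> clist)
    (c : clist -> bool) (s : seq (V * V)) : nat :=
  count (fun p => ~~ c (col p.1 p.2)) s.

Lemma leq_two_rows (a a' c c' d d' g g' k m : nat) :
  a + a' + c + c' <= k -> d + d' + g + g' <= k -> 2 * k <= m ->
  a + a' + d + d' + (c + c' + g + g') <= m.
Proof. lia. Qed.

(** Ordered pairs of vertices split into matched ([A]), mixed ([M], twice) and unmatched ([R]). The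
    finite checks bound [A] and [M], and two unmatched vertices share at most one colour. The linear
    term collects the exceptional couples in [A] and the exceptional vertices in [M]. *)
Lemma total_le (V : finType) (col : V -> V -> clist) (S : {set V}) s r w b e f k :
  gallai col ->
  (forall x y, x \in S -> y \in S -> ncol (col x y) < 3) ->
  maximum_matching col S s r ->
  pair_pair_check w b e k -> pair_vertex_check w b f ->
  [&& w.1.1 <= b, w.1.2 <= b, w.2 <= b, 2 * k <= 8 * b + e.1.2
    & 2 * k <= 8 * b + e.2] ->
  total col w S <= b * #|S| ^ 2
    + (e.1.1 * missing_count col col1 s ^ 2
       + e.1.2 * missing_count col col2 s ^ 2
       + e.2 * missing_count col col3 s ^ 2)
    + 2 * size r * (f.1.1 * missing_count col col1 s
       + f.1.2 * missing_count col col2 s + f.2 * missing_count col col3 s)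
    + (2 + 4 * (w.1.1 + w.1.2 + w.2)) * size s.
Proof.
move=> gcol small [permS dbl rr ex] ppc pvc /and5P [wb1 wb2 wb3 k2 k3].
have [symc irrc nr] := gcol.
have uS : uniq (verts s ++ r) by rewrite -(perm_uniq permS) enum_uniq.
have [us ur] : uniq (verts s) /\ uniq r.
  by move: uS; rewrite cat_uniq => /and3P [].
have memS x : (x \in S) = (x \in verts s) || (x \in r).
  by rewrite -mem_enum (perm_mem permS) mem_cat.
have p1S p : p \in s -> p.1 \in S by rewrite memS => /mem_verts /andP [->].
have p2S p : p \in s -> p.2 \in S by rewrite memS => /mem_verts /andP [_ ->].
have rS y : y \in r -> y \in S by rewrite memS orbC => ->.
have dbls : all (fun p => ncol (col p.1 p.2) == 2) s.
  by apply/allP => p /dbl ->.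
have sumS (F : V -> nat) : \sum_(x in S) F x =
    \sum_(p <- s) (F p.1 + F p.2) + \sum_(y <- r) F y.
  by rewrite -big_enum /= (perm_big _ permS) big_cat /= sum_verts.
have cardS : #|S| = 2 * size s + size r.
  by rewrite cardE (perm_size permS) size_cat size_verts.
set A := \sum_(p <- s) \sum_(q <- s) pair_weight col w p q.
set M := \sum_(p <- s) \sum_(y <- r)
  (weight w (col p.1 y) + weight w (col p.2 y)).
set R := \sum_(x <- r) \sum_(y <- r) weight w (col x y).
have totalE : total col w S = A + 2 * M + R.
  have M' : \sum_(y <- r) \sum_(p <- s)
      (weight w (col y p.1) + weight w (col y p.2)) = M.
    rewrite /M exchange_big; apply: eq_bigr => p _; apply: eq_bigr => y _.
    by rewrite !(symc y).
  rewrite /total sumS.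
  have -> : \sum_(x <- r) \sum_(y in S) weight w (col x y) = M + R.
    by rewrite -M' -big_split; apply: eq_bigr => x _; rewrite sumS.
  have -> : \sum_(p <- s) (\sum_(y in S) weight w (col p.1 y)
      + \sum_(y in S) weight w (col p.2 y)) = A + M.
    rewrite -big_split; apply: eq_bigr => p _; rewrite !sumS /=.
    rewrite addnACA -!big_split /=.
    by congr (_ + _); apply: eq_bigr => q _; rewrite /pair_weight; lia.
  lia.
have Abound : A <= \sum_(p <- s) \sum_(q <- s)
    pair_bound b e (col p.1 p.2) (col q.1 q.2) + 2 * size s.
  apply: sum_pairs_le.
  - by move=> p q; rewrite /pair_weight (symc q.1 p.1) (symc q.1 p.2)
      (symc q.2 p.1) (symc q.2 p.2);
      congr (_ + _); exact: addnAC.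
  - by move=> p q; rewrite /pair_bound eq_sym; case: eqP => // ->.
  - exact: uniq_verts.
  - move=> p ps; rewrite /pair_weight /pair_bound !irrc (symc p.2).
    apply: leq_trans (leq_addr _ _); rewrite addn0.
    exact: weight_double_le (dbl p ps) wb1 wb2 wb3.
  - move=> p q ps qs npq.
    have ppP t t' : t \in s -> t' \in s -> _ :=
      fun ts t's => pair_pair_checkP gcol ppc (dbl t ts) (dbl t' t's)
       (small _ _ (p1S t ts) (p1S t' t's)) (small _ _ (p1S t ts) (p2S t' t's))
       (small _ _ (p2S t ts) (p1S t' t's)) (small _ _ (p2S t ts) (p2S t' t's)).
    have [|[Wpq /and3P [na c1p c1q] vqc]] := ppP p q ps qs; [by left|right].
    split=> // t ts ntp ntq.
    (* Exceptions occur only between pairs containing colour 1. If [t] lacks it, [t] obeys the bound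
       against [p] and [q] separately; otherwise each end of [t] has weight at most [k] towards the
       four vertices, and [2 * k] is within the joint bound. *)
    have [c1t|c1t] := boolP (col1 (col t.1 t.2)); last first.
      by apply: leq_add; [have [|[_]] := ppP t p ts ps
        |have [|[_]] := ppP t q ts qs]; rewrite // (negPf c1t) andbF.
    have vq y : y \in S -> weight w (col y p.1) + weight w (col y p.2)
        + weight w (col y q.1) + weight w (col y q.2) <= k.
      by move=> yS; apply: vertex_quad_checkP vqc _ _ _ _ => //;
        apply: small => //; by [exact: p1S|exact: p2S].
    rewrite pair_bound_add ?dbl //.
    have : 2 * k <= 8 * b + at_missing e (col t.1 t.2).
      by rewrite /at_missing c1t /=; case: ifP.
    exact: leq_two_rows (vq _ (p1S t ts)) (vq _ (p2S t ts)).
have Mbound : M <= \sum_(p <- s) ((2 * b + at_missing f (col p.1 p.2)) * size r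
    + 2 * (w.1.1 + w.1.2 + w.2)).
  rewrite /M big_seq [X in _ <= X]big_seq; apply: leq_sum => p ps.
  apply: sum_pair_rest => //; first exact: dbl.
  - by move=> y yr; apply: small; [exact: p1S|exact: rS].
  - by move=> y yr; apply: small; [exact: p2S|exact: rS].
  - by move=> y z yr zr; exact: ex.
have Rbound : R <= b * size r ^ 2.
  have -> : b * size r ^ 2 = \sum_(x <- r) \sum_(y <- r) b.
    by rewrite !big_const_seq !count_predT !iter_addn_0; lia.
  rewrite /R big_seq [X in _ <= X]big_seq; apply: leq_sum => x xr.
  rewrite big_seq [X in _ <= X]big_seq; apply: leq_sum => y yr.
  exact: weight_single_le (rr x y xr yr) wb1 wb2 wb3.
move: Abound Mbound Rbound; rewrite totalE cardS.
rewrite (sum_pair_bound _ _ dbls) big_split /= -big_distrl /= big_split /=.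
rewrite sum_at_missing // !big_const_seq !count_predT !iter_addn_0 /=.
rewrite -!/(missing_count _ _ _).
set n1 := missing_count col col1 s; set n2 := missing_count col col2 s.
set n3 := missing_count col col3 s; nia.
Qed.

(** [total] counts edges twice, so the coefficient is [1 + t^2] and not its half. [C] allows a
    linear error, removed later by blowing up. *)
Definition some_pair_small (R : realFieldType) (t : R) (V : finType)
    (col : V -> V -> clist) (C : R) (S : {set V}) : Prop :=
  let B : R := ((1 + t ^+ 2) * #|S|%:R ^+ 2 + C * #|S|%:R)%R in
  [\/ ((total col (0, 1, 1) S)%:R <= B)%R, ((total col (1, 0, 1) S)%:R <= B)%R
    | ((total col (1, 1, 0) S)%:R <= B)%R].

Lemma total_linear (V : finType) (col : V -> V -> clist) (S : {set V}) a b c :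
  total col (b + c, a + c, a + b) S =
  a * total col (0, 1, 1) S + b * total col (1, 0, 1) S
  + c * total col (1, 1, 0) S.
Proof.
rewrite /total !big_distrr -!big_split; apply: eq_bigr => x _ /=.
rewrite !big_distrr -!big_split; apply: eq_bigr => y _ /=.
by rewrite /weight; case: (col x y) => [[[] []] []] /=; lia.
Qed.

(** * Recolouring, deletion and blow-up *)

Definition swap12 (l : clist) : clist := (col2 l, col1 l, col3 l).
Definition swap13 (l : clist) : clist := (col3 l, col2 l, col1 l).

(** Used with [swap12] and [swap13] to make colour 1 the one missing from most matched pairs. *)
Lemma gallai_recolor (V : Type) (col : V -> V -> clist) (f : clist -> clist) :
  f (false, false, false) = (false, false, false) ->
  (forall a b c, no_rainbow (f a) (f b) (f c) = no_rainbow a b c) ->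
  gallai col -> gallai (fun x y => f (col x y)).
Proof.
move=> f0 fnr [symc irrc nr]; split=> [x y|x|x y z].
- by rewrite symc.
- by rewrite irrc.
- by rewrite fnr.
Qed.

Lemma no_rainbow_swap12 a b c :
  no_rainbow (swap12 a) (swap12 b) (swap12 c) = no_rainbow a b c.
Proof.
by case: a => [[[] []] []]; case: b => [[[] []] []]; case: c => [[[] []] []].
Qed.

Lemma no_rainbow_swap13 a b c :
  no_rainbow (swap13 a) (swap13 b) (swap13 c) = no_rainbow a b c.
Proof.
by case: a => [[[] []] []]; case: b => [[[] []] []]; case: c => [[[] []] []].
Qed.

Lemma ncol_swap12 l : ncol (swap12 l) = ncol l.
Proof. by case: l => [[[] []] []]. Qed.

Lemma ncol_swap13 l : ncol (swap13 l) = ncol l.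
Proof. by case: l => [[[] []] []]. Qed.

Lemma maximum_matching_recolor (V : finType) (col : V -> V -> clist)
    (f : clist -> clist) (S : {set V}) s r :
  (forall l, ncol (f l) = ncol l) -> maximum_matching col S s r ->
  maximum_matching (fun x y => f (col x y)) S s r.
Proof.
move=> fn [H1 H2 H3 H4]; split=> // [p ps|x y xr yr|p y z ps yr zr].
- by rewrite fn H2.
- by rewrite fn H3.
- by rewrite !fn; exact: H4.
Qed.

Lemma total_swap12 (V : finType) (col : V -> V -> clist) (S : {set V}) a b c :
  total (fun x y => swap12 (col x y)) (a, b, c) S = total col (b, a, c) S.
Proof.
apply: eq_bigr => x _; apply: eq_bigr => y _.
by rewrite /weight /swap12 /=; case: (col x y) => [[[] []] []] /=; lia.
Qed.

Lemma total_swap13 (V : finType) (col : V -> V -> clist) (S : {set V}) a b c :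
  total (fun x y => swap13 (col x y)) (a, b, c) S = total col (c, b, a) S.
Proof.
apply: eq_bigr => x _; apply: eq_bigr => y _.
by rewrite /weight /swap13 /=; case: (col x y) => [[[] []] []] /=; lia.
Qed.

Lemma total_setU2 (V : finType) (col : V -> V -> clist) (S : {set V}) w u v :
  gallai col -> u != v -> u \notin S -> v \notin S ->
  total col w (u |: (v |: S)) =
  total col w S + 2 * \sum_(x in S) (weight w (col u x) + weight w (col v x))
  + 2 * weight w (col u v).
Proof.
move=> [symc irrc _] uv uS vS.
have uS' : u \notin v |: S by rewrite !inE negb_or uv.
rewrite /total !big_setU1 //= !irrc (symc v u).
rewrite [X in _ + (_ + X) = _](eq_bigr (fun x => weight w (col u x)
  + weight w (col v x) + \sum_(y in S) weight w (col x y))) => [|x _].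
  by rewrite !big_split /=; have -> : weight w (false, false, false) = 0 by []; lia.
by rewrite !big_setU1 //= (symc x u) (symc x v) addnA.
Qed.

(** Distinct colours, one in [x] and one in [y], would form a rainbow triangle with the third colour
    from [a]. So one list is empty or both consist of the same single colour. *)
Lemma triple_vertex_le a x y : ncol a = 3 -> no_rainbow a x y ->
  [/\ weight (0, 1, 1) x + weight (0, 1, 1) y <= 2,
      weight (1, 0, 1) x + weight (1, 0, 1) y <= 2
    & weight (1, 1, 0) x + weight (1, 1, 0) y <= 2].
Proof.
by case: a => [[[] []] []]; case: x => [[[] []] []]; case: y => [[[] []] []].
Qed.

Lemma total_blowup (V : finType) (m : nat) (col : V -> V -> clist) w :
  total (fun x y : V * 'I_m => col x.1 y.1) w [set: V * 'I_m] =
  m ^ 2 * total col w [set: V].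
Proof.
have blow (F : V -> nat) : \sum_(x in [set: V * 'I_m]) F x.1 =
    m * \sum_(x in [set: V]) F x.
  rewrite (eq_bigl xpredT) => [|x]; last by rewrite inE.
  rewrite [in RHS](eq_bigl xpredT) => [|x]; last by rewrite inE.
  rewrite -(pair_big xpredT xpredT (fun x _ => F x)) /= big_distrr.
  by apply: eq_bigr => x _; rewrite sum_nat_const card_ord.
rewrite /total (blow (fun x => \sum_(y in _) weight w (col x y.1))).
rewrite -mulnn -mulnA; congr (_ * _); rewrite big_distrr.
by apply: eq_bigr => x _; rewrite (blow (fun y => weight w (col x y))).
Qed.

Local Open Scope ring_scope.

(** * Optimisation of the sizes *)

(** Concavity: at [q] the quadratic exceeds its chord by [a * (q - u) * (v - q)]. *)
Lemma concave_quadratic_ge0 (R : realFieldType) (a b c u v q : R) :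
  0 <= a -> u <= q <= v -> 0 <= c + b * u - a * u ^+ 2 ->
  0 <= c + b * v - a * v ^+ 2 -> 0 <= c + b * q - a * q ^+ 2.
Proof.
move=> a0 /andP [uq qv] Hu Hv.
have [uv|uv] := ltP u v; last first.
  by have -> : q = u by apply/eqP; rewrite eq_le uq (le_trans qv uv).
rewrite -(pmulr_rge0 _ (_ : 0 < v - u)) ?subr_gt0 //.
have -> : (v - u) * (c + b * q - a * q ^+ 2) =
  (v - q) * (c + b * u - a * u ^+ 2) + (q - u) * (c + b * v - a * v ^+ 2)
  + a * ((q - u) * (v - q) * (v - u)) by ring.
have uq' : 0 <= q - u by rewrite subr_ge0.
have qv' : 0 <= v - q by rewrite subr_ge0.
have uv' : 0 <= v - u by rewrite subr_ge0 ltW.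
by apply: addr_ge0; [apply: addr_ge0|]; rewrite !mulr_ge0.
Qed.

(** Here [x], [y], [z] are m_1, m_2, m_3, with colours 2 and 3 exchanged if necessary, [q] is m_3 +
    r and [T] is t n, so the last hypothesis reads T^2 < P_3. *)
Lemma sizes_gt0 (R : realFieldType) (x y z r q N T : R) :
  0 <= z -> 0 <= r -> z <= y -> y <= x -> q = z + r -> N = x + y + q ->
  9 * T ^+ 2 - 8 * T * N + N ^+ 2 = 0 ->
  15 / 100 * N <= T -> T <= 151 / 1000 * N -> T ^+ 2 < z * q ->
  [/\ 0 < z, 0 < N, 0 < T & 0 < q].
Proof.
move=> z0 r0 zy yx qE NE TE T_ge T_le zq.
have z1 : 0 < z.
  rewrite lt_neqAle z0 andbT; apply/eqP => zE.
  by move: zq; rewrite -zE mul0r ltNge sqr_ge0.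
by split; lra.
Qed.

Lemma quadratic_bound4_rest (R : realFieldType) (x y z r q N T : R) :
  0 <= z -> 0 <= r -> z <= y -> y <= x -> q = z + r -> N = x + y + q ->
  9 * T ^+ 2 - 8 * T * N + N ^+ 2 = 0 ->
  15 / 100 * N <= T -> T <= 151 / 1000 * N -> T ^+ 2 < z * q ->
  y <= q ->
  2 * x ^+ 2 + 4 * (y * (y + r) + z * (z + r)) <= N ^+ 2 + 7 * T ^+ 2.
Proof.
move=> z0 r0 zy yx qE NE TE T_ge T_le zq yq.
have [z1 N0 T0 q0] := sizes_gt0 z0 r0 zy yx qE NE TE T_ge T_le zq.
have xE : x = N - y - q by rewrite NE; ring.
suff H : 2 * x ^+ 2 + 8 * (y * q) <= N ^+ 2 + 7 * T ^+ 2.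
  apply: le_trans H; rewrite -subr_ge0.
  have -> : 2 * x ^+ 2 + 8 * (y * q)
      - (2 * x ^+ 2 + 4 * (y * (y + r) + z * (z + r)))
    = 4 * ((q - y) * (y - z)) by rewrite qE; ring.
  by rewrite !mulr_ge0 ?subr_ge0.
have y_gt0 : 0 < y by nra.
have yqT : T ^+ 2 <= y * q by apply: le_trans (ltW zq) _; rewrite ler_wpM2r // ltW.
(* [H t] is the gap [N^2 + 7 T^2 - 2 x^2 - 8 y t] with [x = N - y - t], concave in [t]. It is
   checked at the ends of the range of [q]: [y <= x] gives [q <= N - 2 y], and [q] is at least [y]
   and [T^2 / y]. *)
pose H t := (N ^+ 2 + 7 * T ^+ 2 - 2 * (N - y) ^+ 2) + (4 * (N - y) - 8 * y) * t
  - 2 * t ^+ 2.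
suff Hq : 0 <= H q by rewrite -subr_ge0 xE; move: Hq; rewrite /H; lra.
have Hend : 0 <= H (N - 2 * y).
  have h1 : 0 <= (y - 2 / 7 * N) ^+ 2 by exact: sqr_ge0.
  have h2 : 0 <= (T - 15 / 100 * N) * (T + 15 / 100 * N).
    by rewrite mulr_ge0 //; lra.
  have h3 : 0 <= N ^+ 2 by exact: sqr_ge0.
  by rewrite /H; lra.
have [Ty|yT] := leP T y.
  apply: (@concave_quadratic_ge0 _ 2 _ _ y (N - 2 * y)) => //.
    by rewrite yq; lra.
  rewrite -/(H y).
  have -> : H y = 8 * ((y - T) * (N - 2 * y - 2 * T)).
    by rewrite /H; have := TE; lra.
  rewrite mulr_ge0 // mulr_ge0 ?subr_ge0 //; lra.
(* At this left end [y + u >= 2 T], so the gap is at least [N^2 - T^2 - 2 (N - 2 T)^2], which is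
   zero by the equation for [T]. *)
pose u := T ^+ 2 / y.
have yu : y * u = T ^+ 2 by rewrite /u mulrC divfK ?gt_eqF.
have uq : u <= q by rewrite ler_pdivrMr // mulrC.
have qN : q <= N - 2 * y by lra.
apply: (@concave_quadratic_ge0 _ 2 _ _ u (N - 2 * y)) => //; first by rewrite uq.
have yuT : 2 * T <= y + u.
  have : 0 <= (y - T) ^+ 2 by exact: sqr_ge0.
  rewrite -(ler_pM2l y_gt0); nra.
have : (N - y - u) ^+ 2 <= (N - 2 * T) ^+ 2 by rewrite ler_sqr ?nnegrE; lra.
have := TE; nra.
Qed.

(** From [z <= q] follows [T^2 < q^2], and [z q > T^2 >= q (2 T - q)] bounds [r = q - z]. *)
Lemma rest_le (R : realFieldType) (x y z r q N T : R) :
  0 <= z -> 0 <= r -> z <= y -> y <= x -> q = z + r -> N = x + y + q ->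
  9 * T ^+ 2 - 8 * T * N + N ^+ 2 = 0 ->
  15 / 100 * N <= T -> T <= 151 / 1000 * N -> T ^+ 2 < z * q ->
  r <= 2 * (q - T) /\ T <= q.
Proof.
move=> z0 r0 zy yx qE NE TE T_ge T_le zq.
have [z1 N0 T0 q0] := sizes_gt0 z0 r0 zy yx qE NE TE T_ge T_le zq.
have Tq : T <= q.
  rewrite leNgt; apply/negP => qT.
  have h1 : 0 <= (q - z) * q by rewrite mulr_ge0 //; lra.
  have h2 : 0 <= (T - q) * (T + q) by rewrite mulr_ge0 //; lra.
  lra.
split=> //; suff : 2 * T - q <= z by rewrite qE; lra.
rewrite -(ler_pM2l q0).
have : 0 <= (q - T) ^+ 2 by exact: sqr_ge0.
lra.
Qed.

Lemma quadratic_bound4_small (R : realFieldType) (x y z r q N T : R) :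
  0 <= z -> 0 <= r -> z <= y -> y <= x -> q = z + r -> N = x + y + q ->
  9 * T ^+ 2 - 8 * T * N + N ^+ 2 = 0 ->
  15 / 100 * N <= T -> T <= 151 / 1000 * N -> T ^+ 2 < z * q ->
  q <= y -> 3 * y <= N - T ->
  2 * x ^+ 2 + 4 * (y * (y + r) + z * (z + r)) <= N ^+ 2 + 7 * T ^+ 2.
Proof.
move=> z0 r0 zy yx qE NE TE T_ge T_le zq qy yN.
have [z1 N0 T0 q0] := sizes_gt0 z0 r0 zy yx qE NE TE T_ge T_le zq.
have [rq Tq] := rest_le z0 r0 zy yx qE NE TE T_ge T_le zq.
have xE : x = N - y - q by rewrite NE; ring.
(* For [y >= q] the left side grows with [r], so [r] may be replaced by [2 (q - T)]. The remaining
   gap vanishes at [y = q = T] by the equation for [T]; expanded there, it is the product in [H2],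
   plus that in [H3], plus twice the square in [H4]. *)
have H1 : 0 <= (2 * (q - T) - r) * (y - q) by rewrite mulr_ge0 ?subr_ge0.
have H2 : 0 <= (q - T) * (4 * N - 12 * y - 4 * T).
  by rewrite mulr_ge0 ?subr_ge0 //; lra.
have H3 : 0 <= (y - T) * (4 * N - 6 * y - 10 * T).
  by rewrite mulr_ge0 ?subr_ge0 //; lra.
have H4 : 0 <= (q - T) ^+ 2 by exact: sqr_ge0.
have zE : z = q - r by rewrite qE; ring.
have := TE; rewrite -qE xE zE; lra.
Qed.

(** The constants are 1.1125 = 1 + 5 * 0.15^2 and 0.283 = (1 - 0.151) / 3. The gap is concave in
    [y], which leaves two quadratics in [q]. *)
Lemma quadratic_numeric (R : realFieldType) (y q N : R) :
  0 < N -> 0 < q -> 283 / 1000 * N <= y -> y <= (N - q) / 2 ->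
  2 * (N - y - q) ^+ 2 + 3 * y ^+ 2 + 3 * q ^+ 2
    + 2 * (q - 15 / 100 * N) * (3 * y + (N - y - q) - 3 * q)
  <= 11125 / 10000 * N ^+ 2.
Proof.
move=> N0 q0 y_ge y_le.
pose c := 11125 / 10000 * N ^+ 2 - 2 * (N - q) ^+ 2 - 3 * q ^+ 2
  - 2 * (q - 15 / 100 * N) * (N - 4 * q).
pose b := 4 * (N - q) - 4 * (q - 15 / 100 * N).
have qN : q <= 434 / 1000 * N by clear b c; lra.
suff : 0 <= c + b * y - 5 * y ^+ 2 by rewrite /c /b; clear; lra.
have y_int : 283 / 1000 * N <= y <= (N - q) / 2 by rewrite y_ge.
have N2 : 0 < N ^+ 2 by rewrite exprn_gt0.
(* The squares are centred near the minimum in [q] of the gap at each end of the interval for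
   [y]. *)
have h1 : 0 <= (q - 245 / 1000 * N) ^+ 2 by exact: sqr_ge0.
have h2 : 0 <= (q - 261 / 1000 * N) ^+ 2 by exact: sqr_ge0.
have h3 : 0 <= q * N by rewrite mulr_ge0 // ltW.
have h4 : q * N <= 434 / 1000 * N * N by rewrite ler_wpM2r // ltW.
apply: (concave_quadratic_ge0 _ y_int) => //.
  by rewrite /c /b; clear -h1 h3 h4 N2; lra.
by rewrite /c /b; clear -h2 h3 h4 N2; lra.
Qed.

Lemma quadratic_bound3_large (R : realFieldType) (x y z r q N T : R) :
  0 <= z -> 0 <= r -> z <= y -> y <= x -> q = z + r -> N = x + y + q ->
  9 * T ^+ 2 - 8 * T * N + N ^+ 2 = 0 ->
  15 / 100 * N <= T -> T <= 151 / 1000 * N -> T ^+ 2 < z * q ->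
  q <= y -> N - T <= 3 * y ->
  2 * x ^+ 2 + 3 * (y * (y + r) + z * (z + r)) + x * r <= N ^+ 2 + 5 * T ^+ 2.
Proof.
move=> z0 r0 zy yx qE NE TE T_ge T_le zq qy yN.
have [z1 N0 T0 q0] := sizes_gt0 z0 r0 zy yx qE NE TE T_ge T_le zq.
have [rq Tq] := rest_le z0 r0 zy yx qE NE TE T_ge T_le zq.
have xE : x = N - y - q by rewrite NE; ring.
have zE : z = q - r by rewrite qE; ring.
(* The left side grows with [r] at rate [3 y + x - 3 q]; [r] is replaced by [2 (q - T)], then [T] by
   [15 / 100 * N]. *)
have H1 : 0 <= (2 * (q - T) - r) * (3 * y + x - 3 * q).
  by rewrite mulr_ge0 ?subr_ge0 //; lra.
have H2 : 0 <= (T - 15 / 100 * N) * (3 * y + x - 3 * q).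
  by rewrite mulr_ge0 ?subr_ge0 //; lra.
have H3 : 0 <= (T - 15 / 100 * N) * (T + 15 / 100 * N).
  by rewrite mulr_ge0 ?subr_ge0 //; lra.
suff : 2 * x ^+ 2 + 3 * y ^+ 2 + 3 * q ^+ 2
    + 2 * (q - 15 / 100 * N) * (3 * y + x - 3 * q) <= 11125 / 10000 * N ^+ 2.
  by rewrite -qE zE; lra.
rewrite xE; apply: quadratic_numeric; lra.
Qed.

(** When every s_k is large, the alternatives contradict the bounds on s_1 + 3 (s_2 + s_3) and s_1 +
    2 (s_2 + s_3), whose coefficients add up to 7 and 5. With [z <= y], the first is proved if
    [y <= z + r] or [3 y <= N - T], the second otherwise. *)
Lemma quadratic_bounds (R : realFieldType) (x y z r N T : R) :
  0 <= y -> 0 <= z -> 0 <= r -> y <= x -> z <= x -> N = x + y + z + r ->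
  9 * T ^+ 2 - 8 * T * N + N ^+ 2 = 0 ->
  15 / 100 * N <= T -> T <= 151 / 1000 * N ->
  T ^+ 2 < y * (y + r) -> T ^+ 2 < z * (z + r) ->
  2 * x ^+ 2 + 4 * (y * (y + r) + z * (z + r)) <= N ^+ 2 + 7 * T ^+ 2 \/
  2 * x ^+ 2 + 3 * (y * (y + r) + z * (z + r)) + x * r <= N ^+ 2 + 5 * T ^+ 2.
Proof.
move=> y0 z0 r0 yx zx NE TE T_ge T_le yr zr.
wlog zy : y z y0 z0 yx zx NE yr zr / z <= y.
  move=> wlog_zy; have [zy|/ltW yz] := leP z y; first exact: wlog_zy.
  rewrite (addrC (y * _)); apply: wlog_zy => //; rewrite NE; ring.
have NE' : N = x + y + (z + r) by rewrite NE; ring.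
have [yq|/ltW qy] := leP y (z + r).
  by left; exact: quadratic_bound4_rest z0 r0 zy yx erefl NE' TE T_ge T_le zr yq.
have [yN|/ltW yN] := leP (3 * y) (N - T).
  by left; exact: quadratic_bound4_small z0 r0 zy yx erefl NE' TE T_ge T_le zr
    qy yN.
by right; exact: quadratic_bound3_large z0 r0 zy yx erefl NE' TE T_ge T_le zr qy yN.
Qed.

(** * Two colours with few edges *)

(** The constant 5 covers the linear errors: [10 * size s] is at most [5 * #|S|] for s_2 and s_3,
    while 58 and 42 times [size s] stay below 7 * 5 and 5 * 5 times [#|S|]. *)
Lemma no_triple_case (R : realFieldType) (t : R) (V : finType)
    (col : V -> V -> clist) (S : {set V}) s r :
  9 * t ^+ 2 - 8 * t + 1 = 0 -> 15 / 100 <= t -> t <= 151 / 1000 ->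
  gallai col ->
  (forall x y, x \in S -> y \in S -> (ncol (col x y) < 3)%N) ->
  maximum_matching col S s r ->
  (missing_count col col2 s <= missing_count col col1 s)%N ->
  (missing_count col col3 s <= missing_count col col1 s)%N ->
  some_pair_small t col 5 S.
Proof.
move=> tE t_ge t_le gcol small mm n21 n31.
have bound w b e f k ppc pvc wbk :=
  @total_le V col S s r w b e f k gcol small mm ppc pvc wbk.
have b2 := bound _ _ _ (0, 1, 0)%N _ pair_pair_check_101 isT isT.
have b3 := bound _ _ _ (0, 0, 1)%N _ pair_pair_check_110 isT isT.
have k3 := bound _ _ _ (0, 4, 4)%N _ pair_pair_check_644 isT isT.
have k2 := bound _ _ _ (1, 3, 3)%N _ pair_pair_check_433 isT isT.
move: k3 k2; rewrite -[(6, 4, 4)%N]/(3 + 3, 1 + 3, 1 + 3)%N.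
rewrite -[(4, 3, 3)%N]/(2 + 2, 1 + 2, 1 + 2)%N !total_linear.
have cardS : #|S| = (2 * size s + size r)%N.
  by case: mm => permS _ _ _; rewrite cardE (perm_size permS) size_cat size_verts.
have sizes : size s = (missing_count col col1 s + missing_count col col2 s
    + missing_count col col3 s)%N.
  case: mm => _ dbl _ _; rewrite /missing_count.
  elim: s dbl {cardS n21 n31 bound b2 b3} => //= p s IH dbl.
  rewrite IH; last by move=> q qs; apply: dbl; rewrite inE qs orbT.
  have := dbl p (mem_head _ _).
  by case: (col p.1 p.2) => [[[] []] []] //= _; lia.
move: cardS sizes n21 n31 b2 b3; rewrite /some_pair_small.
set t1 := total _ (0, 1, 1)%N _; set t2 := total _ (1, 0, 1)%N _.
set t3 := total _ (1, 1, 0)%N _.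
set n1 := missing_count col col1 s; set n2 := missing_count col col2 s.
set n3 := missing_count col col3 s.
set P := size s; set r' := size r; set N := #|S|.
move: t1 t2 t3 n1 n2 n3 P r' N => t1 t2 t3 n1 n2 n3 P r' N /=.
move=> NE PE n21 n31 b2 b3 k3 k2.
case: leP => [|h1]; first by constructor 1.
case: leP => [|h2]; first by constructor 2.
case: leP => [|h3]; first by constructor 3.
exfalso.
have NE' : N%:R = 2 * P%:R + r'%:R :> R by rewrite NE natrD natrM.
have PE' : P%:R = n1%:R + n2%:R + n3%:R :> R by rewrite PE !natrD.
have [m21 m31] : n2%:R <= n1%:R :> R /\ n3%:R <= n1%:R :> R by rewrite !ler_nat.
move: b2 b3 k3 k2 {NE PE n21 n31}; rewrite -!(ler_nat R) !(natrD, natrM, natrX).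
move: h1 h2 h3.
have := ler0n R n1; have := ler0n R n2; have := ler0n R n3; have := ler0n R r'.
move: (t1%:R) (t2%:R) (t3%:R) (n1%:R) (n2%:R) (n3%:R) (P%:R) (r'%:R) (N%:R)
  NE' PE' m21 m31 => {t1 t2 t3 n1 n2 n3 P r' N}.
move=> t1 t2 t3 n1 n2 n3 P r' N NE PE n21 n31 r0 n30 n20 n10.
have N0 : 0 <= N by lra.
have y0 : 0 <= 2 * n2 by lra.
have z0 : 0 <= 2 * n3 by lra.
have yx : 2 * n2 <= 2 * n1 by lra.
have zx : 2 * n3 <= 2 * n1 by lra.
have NE' : N = 2 * n1 + 2 * n2 + 2 * n3 + r' by lra.
have TE : 9 * (t * N) ^+ 2 - 8 * (t * N) * N + N ^+ 2 = 0.
  have -> : 9 * (t * N) ^+ 2 - 8 * (t * N) * N + N ^+ 2 =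
    (9 * t ^+ 2 - 8 * t + 1) * N ^+ 2 by ring.
  by rewrite tE mul0r.
have T_ge : 15 / 100 * N <= t * N by rewrite ler_wpM2r.
have T_le : t * N <= 151 / 1000 * N by rewrite ler_wpM2r.
move=> h1 h2 h3 b2 b3 k3 k2.
have y2 : (t * N) ^+ 2 < 2 * n2 * (2 * n2 + r') by clear k2 k3; lra.
have y3 : (t * N) ^+ 2 < 2 * n3 * (2 * n3 + r') by clear k2 k3; lra.
have [H|H] := quadratic_bounds y0 z0 r0 yx zx NE' TE T_ge T_le y2 y3.
  by clear k2 b2 b3 TE y2 y3; lra.
by clear k3 b2 b3 TE y2 y3; lra.
Qed.

Lemma no_triple_some_pair_small (R : realFieldType) (t : R) (V : finType)
    (col : V -> V -> clist) (S : {set V}) :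
  9 * t ^+ 2 - 8 * t + 1 = 0 -> 15 / 100 <= t -> t <= 151 / 1000 ->
  gallai col ->
  (forall x y, x \in S -> y \in S -> (ncol (col x y) < 3)%N) ->
  some_pair_small t col 5 S.
Proof.
move=> tE t_ge t_le gcol small; have [s [r mm]] := maximum_matchingP gcol small.
set n1 := missing_count col col1 s; set n2 := missing_count col col2 s.
set n3 := missing_count col col3 s.
have [/andP [n21 n31]|/andP [n12 n32]|/andP [n13 n23]] :
    [\/ (n2 <= n1) && (n3 <= n1), (n1 <= n2) && (n3 <= n2)
      | (n1 <= n3) && (n2 <= n3)]%N.
- case: (leqP n2 n1) => h12; case: (leqP n3 n1) => h13; case: (leqP n3 n2) => h23;
  by [constructor 1; lia|constructor 2; lia|constructor 3; lia].
- exact: no_triple_case mm n21 n31.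
- have small' x y : x \in S -> y \in S -> (ncol (swap12 (col x y)) < 3)%N.
    by rewrite ncol_swap12; exact: small.
  have := no_triple_case tE t_ge t_le
    (gallai_recolor erefl no_rainbow_swap12 gcol) small'
    (maximum_matching_recolor ncol_swap12 mm) n12 n32.
  rewrite /some_pair_small !total_swap12; case=> h.
  + by constructor 2.
  + by constructor 1.
  + by constructor 3.
- have small' x y : x \in S -> y \in S -> (ncol (swap13 (col x y)) < 3)%N.
    by rewrite ncol_swap13; exact: small.
  have := no_triple_case tE t_ge t_le
    (gallai_recolor erefl no_rainbow_swap13 gcol) small'
    (maximum_matching_recolor ncol_swap13 mm) n23 n13.
  rewrite /some_pair_small !total_swap13; case=> h.
  + by constructor 3.
  + by constructor 2.
  + by constructor 1.
Qed.

(* Deleting both ends of a pair joined by all three colours costs each sum of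
   two colours at most [2] edges per remaining vertex. *)
Lemma gallai_some_pair_small (R : realFieldType) (t : R) (V : finType)
    (col : V -> V -> clist) (S : {set V}) :
  9 * t ^+ 2 - 8 * t + 1 = 0 -> 15 / 100 <= t -> t <= 151 / 1000 ->
  gallai col -> some_pair_small t col 5 S.
Proof.
move=> tE t_ge t_le gcol; have [n] := ubnP #|S|.
elim: n S => // n IHn S; rewrite ltnS => Sn.
have [/forall_inP small|] := boolP
    [forall x in S, [forall y in S, (ncol (col x y) < 3)%N]].
  apply: no_triple_some_pair_small => // x y xS yS.
  by have /forall_inP := small x xS; exact.
case/forall_inPn => u uS /forall_inPn [v vS]; rewrite -leqNgt => uv3.
have uv : ncol (col u v) = 3.
  by move: uv3; case: (col u v) => [[[] []] []].
have [symc irrc nr] := gcol.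
have nuv : u != v by apply/eqP => uvE; move: uv; rewrite uvE irrc.
pose S' := S :\ u :\ v.
have uS' : u \notin S' by rewrite !inE eqxx andbF.
have vS' : v \notin S' by rewrite !inE eqxx.
have SE : S = u |: (v |: S').
  by rewrite /S' setD1K ?setD1K // !inE eq_sym nuv.
have cardS : #|S| = #|S'|.+2.
  by rewrite {1}SE !cardsU1 vS' in_setU1 negb_or nuv uS'.
have step (w : nat * nat * nat) : (weight w (col u v) <= 2)%N ->
    (forall x, weight w (col u x) + weight w (col v x) <= 2)%N ->
    ((total col w S') %:R <= (1 + t ^+ 2) * #|S'|%:R ^+ 2 + 5 * #|S'|%:R :> R) ->
    ((total col w S)%:R <= (1 + t ^+ 2) * #|S|%:R ^+ 2 + 5 * #|S|%:R :> R).
  move=> wuv wx IH.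
  have sumle : (\sum_(x in S') (weight w (col u x) + weight w (col v x))
      <= 2 * #|S'|)%N.
    by rewrite mulnC -sum_nat_const; apply: leq_sum => x _.
  (* The added [4 * #|S'| + 4] is exactly the growth of the squared number of vertices. *)
  have : (total col w S <= total col w S' + 4 * #|S'| + 4)%N.
    by rewrite {1}SE total_setU2 //; lia.
  rewrite -(ler_nat R) 2!natrD (natrM R 4) => h.
  rewrite cardS -[#|S'|.+2]addn2 natrD.
  have h2 : 0 <= t ^+ 2 * #|S'|%:R by rewrite mulr_ge0 ?sqr_ge0.
  have h3 : 0 <= t ^+ 2 by exact: sqr_ge0.
  lra.
have S'n : (#|S'| < n)%N by move: Sn; rewrite cardS; lia.
have tri x := triple_vertex_le uv (nr u v x).
have := IHn S' S'n; rewrite /some_pair_small /=; case=> H.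
- constructor 1; apply: step H; first by move: uv; case: (col u v) => [[[] []] []].
  by move=> x; case: (tri x).
- constructor 2; apply: step H; first by move: uv; case: (col u v) => [[[] []] []].
  by move=> x; case: (tri x).
- constructor 3; apply: step H; first by move: uv; case: (col u v) => [[[] []] []].
  by move=> x; case: (tri x).
Qed.

(** If all three bounds fail, replacing each vertex by [m] copies multiplies the gaps by [m^2] but
    the linear error [5 N] only by [m], so a large [m] contradicts [gallai_some_pair_small]. *)
Lemma gallai_pair_bound (R : realType) (t : R) (V : finType)
    (col : V -> V -> clist) :
  9 * t ^+ 2 - 8 * t + 1 = 0 -> 15 / 100 <= t -> t <= 151 / 1000 ->
  gallai col -> some_pair_small t col 0 [set: V].
Proof.
move=> tE t_ge t_le gcol; rewrite /some_pair_small mul0r addr0.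
set N : R := #|_|%:R.
case: leP => [|h1]; first by constructor 1.
case: leP => [|h2]; first by constructor 2.
case: leP => [|h3]; first by constructor 3.
exfalso; move: h1; rewrite -subr_gt0; set g1 := (X in 0 < X) => h1.
move: h2; rewrite -subr_gt0; set g2 := (X in 0 < X) => h2.
move: h3; rewrite -subr_gt0; set g3 := (X in 0 < X) => h3.
pose B g := Num.bound (5 * N / g).
have N0 : 0 <= N by exact: ler0n.
pose m := (B g1 + B g2 + B g3).+1.
have large g : 0 < g -> (B g <= m)%N -> 5 * N < m%:R * g.
  move=> g0 Bm; rewrite -ltr_pdivrMr //.
  apply: lt_le_trans (_ : (B g)%:R <= _); last by rewrite ler_nat.
  by apply: archi_boundP; rewrite divr_ge0 ?mulr_ge0 // ltW.
have m0 : 0 < m%:R :> R by rewrite ltr0n.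
have large1 : 5 * N < m%:R * g1.
  by apply: large => //; rewrite /m -addnA ltnW // ltnS leq_addr.
have large2 : 5 * N < m%:R * g2.
  by apply: large => //; rewrite /m (addnC (B g1)) -addnA ltnW // ltnS leq_addr.
have large3 : 5 * N < m%:R * g3.
  by apply: large => //; rewrite /m ltnW // ltnS leq_addl.
pose col' (x y : V * 'I_m) := col x.1 y.1.
have gcol' : gallai col'.
  by case: gcol => symc irrc nr; split=> *; rewrite /col'.
have cardE' : #|[set: V * 'I_m]|%:R = m%:R * N :> R.
  by rewrite /N !cardsT card_prod card_ord mulnC natrM.
have conv w : (total col' w [set: V * 'I_m])%:R
    <= (1 + t ^+ 2) * (m%:R * N) ^+ 2 + 5 * (m%:R * N) ->
    5 * N < m%:R * ((total col w [set: V])%:R - (1 + t ^+ 2) * N ^+ 2) -> False.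
  rewrite total_blowup natrM natrX => le lt.
  have : m%:R * (5 * N) <
    m%:R * (m%:R * ((total col w [set: V])%:R - (1 + t ^+ 2) * N ^+ 2)).
    by rewrite ltr_pM2l.
  lra.
have := gallai_some_pair_small [set: V * 'I_m] tE t_ge t_le gcol'.
rewrite /some_pair_small cardE'; case=> /conv; exact.
Qed.

(** * A balanced linear order *)

Lemma orthogonal_triple (R : fieldType) (p q : 'I_3 -> R) :
  exists2 u : 'I_3 -> R, exists i, u i != 0
    & \sum_i u i * p i = 0 /\ \sum_i u i * q i = 0.
Proof.
pose A : 'M[R]_(3, 2) := \matrix_(i, j) (if j == 0 then p i else q i).
have : kermx A != 0.
  by rewrite -mxrank_eq0 mxrank_ker -lt0n subn_gt0 (leq_ltn_trans (rank_leq_col A)).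
case/rowV0Pn => u /sub_kermxP uA u0.
exists (u 0).
  by apply/existsP; apply: contraNT u0 => /existsPn u0; apply/eqP/rowP => i;
    rewrite mxE; apply/eqP; rewrite -[_ == _]negbK.
split.
  have /matrixP /(_ 0 0) := uA; rewrite !mxE => E; rewrite -[RHS]E.
  by apply: eq_bigr => i _; rewrite mxE.
have /matrixP /(_ 0 1) := uA; rewrite !mxE => E; rewrite -[RHS]E.
by apply: eq_bigr => i _; rewrite mxE.
Qed.

Lemma sum_supported3 (R : pzRingType) (I : finType) (a b c : I) (u : 'I_3 -> R)
    (d : I -> R) :
  a != b -> b != c -> c != a ->
  \sum_k (if k == a then u 0 else if k == b then u 1 else
    if k == c then u 2%:R else 0) * d k =
  \sum_i u i * d (tnth [tuple a; b; c] i).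
Proof.
move=> ab bc ca.
rewrite (bigD1 a) //= (bigD1 b) 1?eq_sym //= (bigD1 c) /=; last first.
  by rewrite ca eq_sym.
rewrite !eqxx (eq_sym b a) (negPf ab) (negPf ca) (eq_sym c b) (negPf bc).
rewrite big1 => [|k /andP [/andP [/negPf-> /negPf->] /negPf->]]; last first.
  by rewrite mul0r.
rewrite !big_ord_recl big_ord0 !addr0 !(tnth_nth a) /=.
by congr (_ + (_ + _)); congr (u _ * _); apply/val_inj.
Qed.

Definition fractional (R : numDomainType) (I : finType) (x : I -> R) : {set I} :=
  [set k | `|x k| != 1].

(* Move along a direction supported on three fractional coordinates until one
   of them reaches [1] or [-1]. *)
Lemma fractional_step (R : realFieldType) (I : finType) (d1 d2 d3 x : I -> R) :
  (forall k, `|x k| <= 1) -> (2 < #|fractional x|)%N ->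
  exists x' : I -> R, [/\ forall k, `|x' k| <= 1,
    \sum_k x' k * d1 k = \sum_k x k * d1 k,
    \sum_k x' k * d2 k = \sum_k x k * d2 k,
    \sum_k x k * d3 k <= \sum_k x' k * d3 k
    & (#|fractional x'| < #|fractional x|)%N].
Proof.
move=> x1 /card_gt2P [a [b [c [[aF bF cF] [ab bc ca]]]]].
pose f (d : I -> R) i := d (tnth [tuple a; b; c] i).
have [u0 [j0 u0j] [u0d1 u0d2]] := orthogonal_triple (f d1) (f d2).
have [u [j uj] [ud1 ud2 ud3]] : exists2 u : 'I_3 -> R, exists i, u i != 0 &
    [/\ \sum_i u i * f d1 i = 0, \sum_i u i * f d2 i = 0
      & 0 <= \sum_i u i * f d3 i].
  have [pos|neg] := lerP 0 (\sum_i u0 i * f d3 i).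
    by exists u0; [exists j0|].
  exists (fun i => - u0 i); first by exists j0; rewrite oppr_eq0.
  have sumN d : \sum_i - u0 i * f d i = - \sum_i u0 i * f d i.
    by rewrite -sumrN; apply: eq_bigr => i _; rewrite mulNr.
  by rewrite !sumN u0d1 u0d2 oppr0 oppr_ge0 ltW.
pose y k := if k == a then u 0 else if k == b then u 1 else
    if k == c then u 2%:R else 0.
have ysum d : \sum_k y k * d k = \sum_i u i * f d i.
  exact: sum_supported3.
have yF k : y k != 0 -> k \in fractional x.
  rewrite /y; case: (k =P a) => [->//|_]; case: (k =P b) => [->//|_].
  by case: (k =P c) => [->//|_]; rewrite eqxx.
have [k0 yk0] : exists k, y k != 0.
  exists (tnth [tuple a; b; c] j).
  have : y (tnth [tuple a; b; c] j) = u j.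
    case: j {uj} => [[|[|[|]]]] // ltj; rewrite /y (tnth_nth a) /=.
    - by rewrite eqxx; congr u; apply/val_inj.
    - by rewrite eq_sym (negPf ab) eqxx; congr u; apply/val_inj.
    - by rewrite (negPf ca) eq_sym (negPf bc) eqxx; congr u; apply/val_inj.
  by move=> ->.
(* Moving along [y], coordinate [k] reaches the sign of [y k] at time [h k]; the least such time
   keeps all others in the cube. *)
pose h k := (1 - Num.sg (y k) * x k) / `|y k|.
have h0 k : 0 <= h k.
  rewrite divr_ge0 // subr_ge0; apply: le_trans (x1 k).
  by apply: le_trans (ler_norm _) _; rewrite normrM normr_sg;
    case: eqP => _; rewrite ?mul1r ?mul0r.
case: (@arg_minP _ _ _ k0 (fun k => y k != 0) h yk0) => m ym hm.
pose x' k := x k + h m * y k.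
have x'sum d : \sum_k x' k * d k = \sum_k x k * d k + h m * \sum_k y k * d k.
  rewrite mulr_sumr -big_split; apply: eq_bigr => k _ /=.
  by rewrite /x' mulrDl mulrA.
have yh k : y k != 0 -> `|y k| * h k = 1 - Num.sg (y k) * x k.
  by move=> yk; rewrite mulrC divfK ?normr_eq0.
have x'1 k : `|x' k| <= 1.
  have [yk|yk] := eqVneq (y k) 0; first by rewrite /x' yk mulr0 addr0.
  have := yh k yk; have := hm k yk; have := x1 k; have := h0 m.
  rewrite /x' !ler_norml; move: yk; rewrite neq_lt => /orP [yk|yk].
    rewrite (ltr0_sg yk) (ltr0_norm yk) => p /andP [p1 p2] p3 p4.
    have := ler_wpM2l (_ : 0 <= - y k) p3; rewrite p4 oppr_ge0 => /(_ (ltW yk)).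
    have : h m * y k <= 0 by rewrite mulr_ge0_le0 // ltW.
    by lra.
  rewrite (gtr0_sg yk) (gtr0_norm yk) => p /andP [p1 p2] p3 p4.
  have := ler_wpM2l (ltW yk) p3; rewrite p4.
  have : 0 <= h m * y k by rewrite mulr_ge0 // ltW.
  by lra.
exists x'; split=> //.
- by rewrite x'sum ysum ud1 mulr0 addr0.
- by rewrite x'sum ysum ud2 mulr0 addr0.
- by rewrite x'sum ysum lerDl mulr_ge0.
apply: proper_card; apply/properP; split.
  apply/subsetP => k; rewrite inE; apply: contraR => kF.
  have : y k == 0 by apply: contraR kF => /yF.
  by move: kF; rewrite inE negbK /x' => /eqP <- /eqP ->; rewrite mulr0 addr0.
exists m; first exact: yF.
rewrite inE negbK; have := yh m ym; have := x1 m; rewrite /x'.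
move: ym; rewrite neq_lt => /orP [yk|yk].
  rewrite (ltr0_sg yk) (ltr0_norm yk) => _ E.
  have -> : x m + h m * y m = -1 by lra.
  by rewrite normrN normr1.
rewrite (gtr0_sg yk) (gtr0_norm yk) => _ E.
have -> : x m + h m * y m = 1 by lra.
by rewrite normr1.
Qed.

(** Start at the centre of the cube, where all sums vanish, and apply [fractional_step] while three
    fractional coordinates remain. *)
Lemma exists_almost_signs (R : realFieldType) (I : finType)
    (d1 d2 d3 : I -> R) :
  exists x : I -> R, [/\ forall k, `|x k| <= 1, \sum_k x k * d1 k = 0,
    \sum_k x k * d2 k = 0, 0 <= \sum_k x k * d3 k
    & (#|fractional x| <= 2)%N].
Proof.
suff H n (x : I -> R) : (#|fractional x| < n)%N -> (forall k, `|x k| <= 1) ->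
    \sum_k x k * d1 k = 0 -> \sum_k x k * d2 k = 0 ->
    0 <= \sum_k x k * d3 k ->
    exists x : I -> R, [/\ forall k, `|x k| <= 1, \sum_k x k * d1 k = 0,
    \sum_k x k * d2 k = 0, 0 <= \sum_k x k * d3 k
    & (#|fractional x| <= 2)%N].
  have sum0 (d : I -> R) : \sum_k 0 * d k = 0 by rewrite -mulr_sumr mul0r.
  apply: (H #|fractional (fun _ : I => 0 : R)|.+1 (fun=> 0)) => //.
  - by move=> k; rewrite normr0.
  - by rewrite sum0.
elim: n x => // n IHn x; rewrite ltnS => xn x1 e1 e2 e3.
have [small|big] := leqP #|fractional x| 2; first by exists x.
have [x' [x'1 f1 f2 f3 lt]] := fractional_step d1 d2 d3 x1 big.
apply: (IHn x') => //; [exact: leq_trans xn|by rewrite f1|by rewrite f2|].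
exact: le_trans f3.
Qed.

Definition sign (R : pzRingType) (b : bool) : R := if b then 1 else -1.

Lemma normM_bounds (R : realFieldType) (x D M : R) :
  `|D| <= M -> - (`|x| * M) <= x * D <= `|x| * M.
Proof. by move=> DM; rewrite -ler_norml normrM ler_wpM2l. Qed.

(* When [`|x1| + `|x2| < 1/2], a single coordinate cannot rule out two of the
   four roundings, so the three coordinates leave at least one of them. *)
Lemma round_two (R : realFieldType) (M x1 x2 : R) (D1 D2 : 'I_3 -> R) :
  `|x1| <= 1 -> `|x2| <= 1 -> (forall i, `|D1 i| <= M) ->
  (forall i, `|D2 i| <= M) ->
  exists e1 e2 : bool, forall i,
    - (3 / 2 * M) <= (sign R e1 - x1) * D1 i + (sign R e2 - x2) * D2 i.
Proof.
move=> x1le x2le D1M D2M.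
have M0 : 0 <= M by apply: le_trans (D1M 0); rewrite normr_ge0.
have nearest x : `|x| <= 1 -> `|sign R (0 <= x) - x| = 1 - `|x|.
  rewrite /sign; case: (lerP 0 x) => x0.
    by rewrite (ger0_norm x0) => xle; rewrite ger0_norm; lra.
  by rewrite (ltr0_norm x0) => xle; rewrite ler0_norm; lra.
have [big|small] := leP (1 / 2) (`|x1| + `|x2|).
  (* Rounding both coordinates to the nearest sign costs at most [2 - |x1| - |x2|] times [M]. *)
  exists (0 <= x1), (0 <= x2) => i.
  have /andP [h1 _] := normM_bounds (sign R (0 <= x1) - x1) (D1M i).
  have /andP [h2 _] := normM_bounds (sign R (0 <= x2) - x2) (D2M i).
  move: h1 h2; rewrite !nearest // => h1 h2.
  have := ler_wpM2r M0 big; lra.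
pose v (e : bool * bool) i :=
  (sign R e.1 - x1) * D1 i + (sign R e.2 - x2) * D2 i.
suff /existsP [e /forallP He] : [exists e, [forall i, - (3 / 2 * M) <= v e i]].
  by exists e.1, e.2 => i; exact: He.
apply: contraT => /existsPn none.
pose f e := odflt ord0 [pick i | v e i < - (3 / 2 * M)].
have fP e : v e (f e) < - (3 / 2 * M).
  rewrite /f; case: pickP => [i //|no]; have /forallPn [i] := none e.
  by rewrite -ltNge; have /= -> := no i.
(* Of four failing roundings two would fail at the same [i]. But the values of two distinct
   roundings add up to at least [- 2 M - 2 (|x1| + |x2|) M], hence to at least [- 3 M]. *)
have /injectivePn [e [e' ne ee']] : ~~ injectiveb f.
  by apply/negP => /injectiveP /leq_card; rewrite card_prod card_bool card_ord.
have := fP e; have := fP e'; rewrite -ee' /v; move: (f e) => i.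
have := normM_bounds x1 (D1M i); have := normM_bounds x2 (D2M i).
have := D1M i; have := D2M i; rewrite !ler_norml.
have := ler_wpM2r M0 (ltW small).
move: e e' ne {ee'} => [[] []] [[] []] //= _; rewrite /sign;
move=> h0 /andP [h1 h2] /andP [h3 h4] /andP [h5 h6] /andP [h7 h8]; lra.
Qed.

Lemma exists_signs (R : realFieldType) (I : finType) (M : R)
    (d : 'I_3 -> I -> R) :
  (forall i k, `|d i k| <= M) -> 0 <= M ->
  exists e : I -> bool, forall i, - (3 / 2 * M) <= \sum_k sign R (e k) * d i k.
Proof.
move=> dM M0.
have [x [x1 s0 s1 s2 card_x]] := exists_almost_signs (d 0) (d 1) (d 2%:R).
have sx i : 0 <= \sum_k x k * d i k.
  case: i => [[|[|[|]]]] // lti.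
  - by rewrite (_ : Ordinal lti = 0) ?s0 //; apply/val_inj.
  - by rewrite (_ : Ordinal lti = 1) ?s1 //; apply/val_inj.
  - by rewrite (_ : Ordinal lti = 2%:R) //; apply/val_inj.
have diff (e : I -> bool) i :
    (forall k, k \notin fractional x -> sign R (e k) = x k) ->
    \sum_k sign R (e k) * d i k =
    \sum_k x k * d i k
    + \sum_(k <- enum (fractional x)) (sign R (e k) - x k) * d i k.
  move=> eF; rewrite big_enum /= [X in _ + X]big_mkcond -big_split.
  apply: eq_bigr => k _ /=; case: ifPn => [_|/eF->]; first by ring.
  by rewrite addr0.
have frac k : k \notin fractional x -> sign R (0 < x k) = x k.
  rewrite inE negbK /sign => /eqP xk; case: ifP => [x0|/negbT].
    by rewrite -xk gtr0_norm.
  by rewrite -leNgt => x0; rewrite -xk ler0_norm // opprK.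
(* A zero coordinate completes the pair when only one coordinate is fractional. *)
have zero2 : forall i : 'I_3, `|(fun _ : 'I_3 => 0 : R) i| <= M.
  by move=> i; rewrite normr0.
have suff_e (e : I -> bool) :
    (forall k, k \notin fractional x -> sign R (e k) = x k) ->
    (forall i, - (3 / 2 * M) <=
      \sum_(k <- enum (fractional x)) (sign R (e k) - x k) * d i k) ->
    exists e : I -> bool, forall i, - (3 / 2 * M) <= \sum_k sign R (e k) * d i k.
  by move=> eF le; exists e => i; rewrite diff // -[leLHS]add0r lerD.
have memF k : (k \in fractional x) = (k \in enum (fractional x)).
  by rewrite mem_enum.
have uF := enum_uniq (fractional x).
move: card_x uF suff_e memF; rewrite cardE.
case: (enum _) => [|a [|b [|//]]] _ /= uF suff_e memF.
- apply: (suff_e (fun k => 0 < x k)) => // i.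
  by rewrite big_nil oppr_le0 mulr_ge0 // divr_ge0.
- have norm01 : `|0 : R| <= 1 by rewrite normr0.
  have [e1 [e2 He]] := round_two (x1 a) norm01 (dM^~ a) zero2.
  apply: (suff_e (fun k => if k == a then e1 else 0 < x k)) => [k kF|i].
    by move: (kF); rewrite memF inE => /negPf->; exact: frac.
  by have := He i; rewrite mulr0 addr0 big_seq1 eqxx.
- have [e1 [e2 He]] := round_two (x1 a) (x1 b) (dM^~ a) (dM^~ b).
  pose e k := if k == a then e1 else if k == b then e2 else 0 < x k.
  apply: (suff_e e) => [k kF|i]; rewrite /e.
    move: (kF); rewrite memF !inE negb_or => /andP [/negPf-> /negPf->].
    exact: frac.
  have := He i; rewrite big_cons big_seq1 !eqxx.
  by move: uF; rewrite inE andbT eq_sym => /negPf->.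
Qed.

(* The vertices are enumerated and, one after the other, placed either before
   or after all the later ones, according to [e]; [order_key] is an explicit
   realisation of the resulting linear order. *)
Definition order_key (V : finType) (e : V -> bool) (x : V) : nat :=
  if e x then enum_rank x : nat else (2 * #|V| - enum_rank x)%N.

Lemma order_key_lt (V : finType) (e : V -> bool) (x y : V) :
  (enum_rank x < enum_rank y)%N -> (order_key e x < order_key e y)%N = e x.
Proof.
rewrite /order_key; have := ltn_ord (enum_rank x); have := ltn_ord (enum_rank y).
move: (nat_of_ord _) (nat_of_ord _) => i j; move: #|V| => n.
by case: (e x); case: (e y); lia.
Qed.

Lemma order_key_gt (V : finType) (e : V -> bool) (x y : V) :
  (enum_rank x < enum_rank y)%N -> (order_key e y < order_key e x)%N = ~~ e x.
Proof.
rewrite /order_key; have := ltn_ord (enum_rank x); have := ltn_ord (enum_rank y).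
move: (nat_of_ord _) (nat_of_ord _) => i j; move: #|V| => n.
by case: (e x); case: (e y); lia.
Qed.

Lemma order_key_inj (V : finType) (e : V -> bool) : injective (order_key e).
Proof.
move=> x y exy; apply: enum_rank_inj; apply: val_inj => /=.
case: (ltngtP (enum_rank x) (enum_rank y)) => // xy.
  have := order_key_lt e xy; have := order_key_gt e xy.
  by rewrite exy ltnn; case: (e x).
have := order_key_lt e xy; have := order_key_gt e xy.
by rewrite exy ltnn; case: (e y).
Qed.

(** * Forward edges and rainbow transitive triangles *)

Definition forward (V : finType) (G : digraph V) (e : V -> bool) (x y : V) :
    bool :=
  if (order_key e x < order_key e y)%N then (x, y) \in edges G
  else (y, x) \in edges G.

Lemma forward_sym (V : finType) (G : digraph V) e x y :
  forward G e x y = forward G e y x.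
Proof.
rewrite /forward; case: ltngtP => // /order_key_inj -> //.
Qed.

Lemma forward_irr (V : finType) (G : digraph V) e x : forward G e x x = false.
Proof. by rewrite /forward ltnn; apply/negbTE/edges_loopless. Qed.

(** Listed by increasing key, the three vertices form a transitive triangle. Of the eight comparison
    patterns two are cyclic, hence impossible. *)
Lemma forward_triangle (V : finType) (G : 'I_3 -> digraph V) e (x y z : V)
    (a b d : 'I_3) :
  uniq [:: a; b; d] -> forward (G a) e x y -> forward (G b) e x z ->
  forward (G d) e y z -> has_rainbow_transitive_triangle G.
Proof.
rewrite /= !inE negb_or andbT => /andP [/andP [ab ad] bd] xya xzb yzd.
have neq c u v : forward (G c) e u v -> u != v.
  by move=> uv; apply/eqP => E; rewrite E forward_irr in uv.
have nxy := neq _ _ _ xya; have nxz := neq _ _ _ xzb.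
have nyz := neq _ _ _ yzd; move: xya xzb yzd; rewrite /forward.
have U (u v w : V) : u != v -> u != w -> v != w -> uniq [:: u; v; w].
  by move=> uv uw vw; rewrite /= !inE negb_or uv uw vw.
have U3 (u v w : 'I_3) : u != v -> u != w -> v != w -> uniq [:: u; v; w].
  by move=> uv uw vw; rewrite /= !inE negb_or uv uw vw.
case: ltngtP => [xy|yx|/order_key_inj E]; last by rewrite E eqxx in nxy.
- case: ltngtP => [xz|zx|/order_key_inj E]; last by rewrite E eqxx in nxz.
  + case: ltngtP => [yz|zy|/order_key_inj E]; last by rewrite E eqxx in nyz.
    * by exists x, y, z, a, d, b; split=> //;
        [apply: U|apply: U3]; rewrite // eq_sym.
    * by exists x, z, y, b, d, a; split=> //;
        [apply: U|apply: U3]; rewrite // eq_sym.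
  + case: ltngtP => [yz|zy|/order_key_inj E]; last by rewrite E eqxx in nyz.
    * by have := ltn_trans (ltn_trans xy yz) zx; rewrite ltnn.
    * by exists z, x, y, b, a, d; split=> //;
        [apply: U|apply: U3]; rewrite // eq_sym.
- case: ltngtP => [xz|zx|/order_key_inj E]; last by rewrite E eqxx in nxz.
  + case: ltngtP => [yz|zy|/order_key_inj E]; last by rewrite E eqxx in nyz.
    * by exists y, x, z, a, b, d; split=> //;
        [apply: U|apply: U3]; rewrite // eq_sym.
    * by have := ltn_trans (ltn_trans xz zy) yx; rewrite ltnn.
  + case: ltngtP => [yz|zy|/order_key_inj E]; last by rewrite E eqxx in nyz.
    * by exists y, z, x, d, b, a; split=> //;
        [apply: U|apply: U3]; rewrite // eq_sym.
    * by exists z, y, x, d, a, b; split=> //;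
        [apply: U|apply: U3]; rewrite // eq_sym.
Qed.

Lemma sum_ranked_pairs (R : zmodType) (V : finType) (F : V -> V -> R) :
  (forall x, F x x = 0) ->
  \sum_x \sum_y F x y =
  \sum_x \sum_(y | (enum_rank x < enum_rank y)%N) (F x y + F y x).
Proof.
move=> F0; under [RHS]eq_bigr do rewrite big_split.
rewrite big_split /= [X in _ = _ + X](exchange_big_dep xpredT) //=.
rewrite -big_split; apply: eq_bigr => x _ /=.
rewrite [LHS](bigID (fun y => (enum_rank x < enum_rank y)%N)) /=; congr (_ + _).
rewrite (bigD1 x) ?ltnn //= F0 add0r; apply: eq_bigl => y.
rewrite -leqNgt (leq_eqVlt (enum_rank y)).
have -> : (nat_of_ord (enum_rank y) == enum_rank x) = (y == x).
  by rewrite (inj_eq val_inj) (inj_eq enum_rank_inj).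
by case: eqVneq => [->|]; rewrite ?ltnn ?andbT //= ?andbF.
Qed.

Definition imbalance (R : pzRingType) (V : finType) (G : digraph V) (x : V) : R :=
  \sum_(y | (enum_rank x < enum_rank y)%N)
    (((x, y) \in edges G)%:R - ((y, x) \in edges G)%:R).

(** The orientation kept between [x] and a later [y] depends on [e x] alone. With [a] and [b] for
    the two possible edges, the ordered pairs contribute [2 a] or [2 b], that is [a + b] plus or
    minus [a - b]. *)
Lemma sum_forward (R : pzRingType) (V : finType) (G : digraph V) e :
  \sum_x \sum_y (forward G e x y)%:R =
  (num_edges G)%:R + \sum_x sign R (e x) * imbalance R G x.
Proof.
rewrite sum_ranked_pairs => [|x]; last by rewrite forward_irr.
have -> : (num_edges G)%:R = \sum_x \sum_y ((x, y) \in edges G)%:R :> R.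
  rewrite /num_edges -sum1_card natr_sum pair_big /= big_mkcond.
  by apply: eq_bigr => [[x y]] _ /=; case: ifP.
rewrite sum_ranked_pairs => [|x]; last by rewrite (negPf (edges_loopless _ _)).
rewrite -big_split; apply: eq_bigr => x _ /=.
rewrite /imbalance mulr_sumr -big_split; apply: eq_bigr => y xy /=.
rewrite (forward_sym _ _ y) /forward order_key_lt // /sign.
have add_add_sub (a b : R) : a + a = a + b + (a - b).
  by rewrite addrACA subrr addr0.
have add_sub_sub (a b : R) : b + b = a + b - (a - b).
  by rewrite opprB [b - a]addrC addrACA subrr add0r.
case: (e x); rewrite /= ?mul1r ?mulN1r.
  exact: add_add_sub.
exact: add_sub_sub.
Qed.

Lemma imbalance_le (R : numDomainType) (V : finType) (G : digraph V) (x : V) :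
  `|imbalance R G x| <= #|V|%:R.
Proof.
apply: le_trans (ler_norm_sum _ _ _) _.
apply: (@le_trans _ _ (\sum_(y | (enum_rank x < enum_rank y)%N) 1%:R)).
  apply: ler_sum => y _; case: (_ \in _); case: (_ \in _);
  by rewrite ?subrr ?subr0 ?sub0r ?normrN ?normr0 ?normr1.
by rewrite -natr_sum sum1dep_card ler_nat max_card.
Qed.

(** Forward edges count twice in these sums, as in [total]. Any two colours together exceed
    [(1 + t^2) n^2], so by [gallai_pair_bound] the forward graphs contain a rainbow triangle. *)
Lemma has_rainbow_of_large_forward (R : realType) (t : R) (V : finType)
    (G : 'I_3 -> digraph V) (e : V -> bool) :
  9 * t ^+ 2 - 8 * t + 1 = 0 -> 15 / 100 <= t -> t <= 151 / 1000 ->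
  (forall i, (1 + t ^+ 2) / 2 * #|V|%:R ^+ 2 <
     \sum_x \sum_y (forward (G i) e x y)%:R :> R) ->
  has_rainbow_transitive_triangle G.
Proof.
move=> tE t_ge t_le large.
pose A i x y := forward (G i) e x y.
pose col x y : clist := (A 0 x y, A 1 x y, A 2%:R x y).
have [/forallP nr|] := boolP
    [forall x, [forall y, [forall z,
      no_rainbow (col x y) (col x z) (col y z)]]]; last first.
  case/forallPn => x /forallPn [y] /forallPn [z]; rewrite negbK /col /=.
  by do 5?[case/orP]; case/and3P => xy xz yz; apply: forward_triangle xy xz yz.
have gcol : gallai col.
  split=> [x y|x|x y z].
  - by rewrite /col /A !(forward_sym _ _ x).
  - by rewrite /col /A !forward_irr.
  - by have /forallP /(_ y) /forallP /(_ z) := nr x.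
have tot (a b : 'I_3) w :
    (forall x y, weight w (col x y) = (A a x y + A b x y)%N) ->
    (total col w [set: V])%:R =
    \sum_x \sum_y (A a x y)%:R + \sum_x \sum_y (A b x y)%:R :> R.
  move=> wE; rewrite -big_split /total natr_sum /=.
  apply: eq_big => [x|x _]; first by rewrite inE.
  rewrite -big_split natr_sum; apply: eq_big => [y|y _]; first by rewrite inE.
  by rewrite wE natrD.
have [] := gallai_pair_bound tE t_ge t_le gcol; rewrite mul0r addr0 cardsT.
- rewrite (@tot 1 2%:R) => [|x y]; last first.
    rewrite /weight /col1 /col2 /=.
    by case: (A 0 x y); case: (A 1 x y); case: (A 2%:R x y).
  by have := large 1; have := large 2%:R; rewrite -/A; lra.
- rewrite (@tot 0 2%:R) => [|x y]; last first.
    rewrite /weight /col1 /col2 /=.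
    by case: (A 0 x y); case: (A 1 x y); case: (A 2%:R x y).
  by have := large 0; have := large 2%:R; rewrite -/A; lra.
- rewrite (@tot 0 1) => [|x y]; last first.
    rewrite /weight /col1 /col2 /=.
    by case: (A 0 x y); case: (A 1 x y); case: (A 2%:R x y).
  by have := large 0; have := large 1; rewrite -/A; lra.
Qed.

Theorem theorem3 (R : realType) (n : nat) (V : finType) (hn : #|V| = n)
    (G : 'I_3 -> digraph V)
    (hG : forall i : 'I_3,
      (num_edges (G i))%:R >
        ((52 - 4 * Num.sqrt 7) / 81) * n%:R ^+ 2 + (3 / 2) * n%:R :> R) :
  has_rainbow_transitive_triangle G.
Proof.
set s : R := Num.sqrt 7 in hG.
have s0 : 0 <= s by exact: sqrtr_ge0.
have s2 : s ^+ 2 = 7 by rewrite sqr_sqrtr.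
(* These bounds on the square root of 7 put [(4 - s) / 9] between 0.15 and 0.151. *)
have s_le : s <= 265 / 100 by rewrite -ler_sqr ?nnegrE //; [lra|lra].
have s_ge : 2641 / 1000 <= s by rewrite -ler_sqr ?nnegrE //; lra.
have [e He] := exists_signs (fun i k => imbalance_le R (G i) k) (ler0n R #|V|).
apply: (@has_rainbow_of_large_forward R ((4 - s) / 9) V G e); [lra|lra|lra|].
have -> : (1 + ((4 - s) / 9) ^+ 2) / 2 = (52 - 4 * s) / 81 by lra.
by move=> i; rewrite sum_forward; have := hG i; have := He i; rewrite hn; lra.
Qed.
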